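(* Let $(\mathcal{H},d)$ be a locally compact Hadamard space, let $(S,\mu)$ be a probability space, and let $f\colon\mathcal{H}\times S\to(-\infty,\infty]$ be a function such that $f(\cdot,\xi)$ is convex and lower semicontinuous on $\mathcal{H}$ for each $\xi\in S$, and $f(x,\cdot)$ is measurable on $S$ for each $x\in\mathcal{H}$. Define $$F(x):=\int_S f(x,\xi)\,\mathrm{d}\mu(\xi),\qquad x\in\mathcal{H},$$ and suppose that $F(x)>-\infty$ for every $x\in\mathcal{H}$ and that $F$ is lower semicontinuous. Let $(\lambda_i)_{i\in\mathbb{N}}$ be a sequence of positive reals, let $(\xi_i)_{i\in\mathbb{N}}$ be a sequence of independent random variables $\xi_i\colon\Omega\to S$, each with distribution $\mu$, defined on a probability space $(\Omega,\mathcal{F},\mathbb{P})$, let $x_0\in\mathcal{H}$ be arbitrary, and let $(x_i)$ be the sequence of $\mathcal{H}$-valued random variables generated by the stochastic proximal point algorithm $$x_i:=J_{\lambda_i}^{\xi_i}x_{i-1},\qquad i\in\mathbb{N},$$ where $J_\lambda^\xi$ denotes the resolvent of $f(\cdot,\xi)$ with parameter $\lambda$. Assume that (i) $F$ has a minimizer; (ii) there exist $p\in\mathcal{H}$ and an $L^2$-function $L\colon S\to(0,\infty)$ (that is, $L$ is measurable and $\int_S L^2\,\mathrm{d}\mu<\infty$) such that $$f(x,\xi)-f(y,\xi)\leq L(\xi)\,\bigl[1+d(x,p)\bigr]\,d(x,y)$$ for all $x,y\in\mathcal{H}$ and all $\xi\in S$; (iii) $\sum_{i=1}^\infty\lambda_i=\infty$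 and $\sum_{i=1}^\infty\lambda_i^2<\infty$. Then there exists a random variable $x\colon\Omega\to\operatorname{Min}F$ such that for almost every $\omega\in\Omega$ the sequence $(x_i(\omega))$ converges to $x(\omega)$.
   Context: A complete metric space $(\mathcal{H},d)$ is a Hadamard space if for each $x,y\in\mathcal{H}$ there is a geodesic $\gamma\colon[0,1]\to\mathcal{H}$ from $x$ to $y$, i.e. a map with $\gamma(0)=x$, $\gamma(1)=y$ and $d(\gamma(s),\gamma(t))=d(x,y)\,|s-t|$ for all $s,t\in[0,1]$, and if for each $z\in\mathcal{H}$, each geodesic $\gamma\colon[0,1]\to\mathcal{H}$ and each $t\in[0,1]$, $$d(z,\gamma(t))^2\leq(1-t)\,d(z,\gamma(0))^2+t\,d(z,\gamma(1))^2-t(1-t)\,d(\gamma(0),\gamma(1))^2.$$ A function $h\colon\mathcal{H}\to(-\infty,\infty]$ is convex if $h\circ\gamma\colon[0,1]\to(-\infty,\infty]$ is convex for every geodesic $\gamma\colon[0,1]\to\mathcal{H}$. For $\lambda>0$ and $\xi\in S$ the resolvent of $f(\cdot,\xi)$ is the map $$J_\lambda^\xi x:=\operatorname*{arg\,min}_{y\in\mathcal{H}}\left[f(y,\xi)+\frac{1}{2\lambda}d(x,y)^2\right],\qquad x\in\mathcal{H}.$$ $\operatorname{Min}F$ denotes the set of minimizers of $F$ on $\mathcal{H}$. Conventions: a minimizer of $F$ is a point at which $F$ attains its infimum, this infimum being finite; the growth inequality in (ii) is understood to include that its left-hand side is well defined (no expression $\infty-\infty$ occurs), so that $f$ is finite-valued.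 *)

(* Defs.v *)
From HB Require Import structures.
From mathcomp Require Import all_boot all_order all_algebra finmap.
From mathcomp Require Import all_classical all_reals all_analysis.

Set Implicit Arguments.
Unset Strict Implicit.
Unset Printing Implicit Defensive.

Import Order.TTheory GRing.Theory Num.Theory.

Local Open Scope classical_set_scope.
Local Open Scope ring_scope.

(* The base point inherited from [Complete] only says that the space is
   nonempty. *)
#[short(type="completeMetricType")]
HB.structure Definition CompleteMetric (R : numDomainType) :=
  {T of Metric R T & Complete T}.

(* Curves [0,1] -> H are represented by functions R -> H, whose values outside
   [0,1] are never used. *)
Definition geodesic (R : realType) (H : metricType R) (gamma : R -> H) : Prop :=
  forall s t : R, 0 <= s <= 1 -> 0 <= t <= 1 ->
    mdist (gamma s) (gamma t) = mdist (gamma 0) (gamma 1) * `|s - t|.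

Definition hadamard (R : realType) (H : completeMetricType R) : Prop :=
  (forall x y : H, exists gamma : R -> H,
     [/\ geodesic gamma, gamma 0 = x & gamma 1 = y]) /\
  (forall (z : H) (gamma : R -> H) (t : R), geodesic gamma -> 0 <= t <= 1 ->
     mdist z (gamma t) ^+ 2 <=
       (1 - t) * mdist z (gamma 0) ^+ 2 + t * mdist z (gamma 1) ^+ 2
       - t * (1 - t) * mdist (gamma 0) (gamma 1) ^+ 2).

(* For functions with values in ]-oo, +oo]; recall that 0 * +oo = 0. *)
Definition convex_on01 (R : realType) (g : R -> \bar R) : Prop :=
  forall s t r : R, 0 <= s <= 1 -> 0 <= t <= 1 -> 0 <= r <= 1 ->
    (g ((1 - r) * s + r * t)%R <= (1 - r)%:E * g s + r%:E * g t)%E.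

Definition geodesically_convex (R : realType) (H : metricType R)
    (h : H -> \bar R) : Prop :=
  forall gamma : R -> H, geodesic gamma -> convex_on01 (h \o gamma).

Definition minimizers (R : realType) (T : Type) (h : T -> \bar R) : set T :=
  [set y | ereal_inf (range h) \is a fin_num /\ h y = ereal_inf (range h)].

(* [xget] picks an element of the set of minimizers, which has exactly one
   element when h is proper, convex and lower semicontinuous on a Hadamard
   space; the default value x is returned only when the set is empty. *)
Definition resolvent (R : realType) (H : metricType R) (h : H -> \bar R)
    (lambda : R) (x : H) : H :=
  xget x (minimizers
    (fun y => h y + ((2 * lambda)^-1 * mdist x y ^+ 2)%:E)%E).

(* The sequences (lambda_i) and (xi_i), i >= 1, are indexed from 0: the i-th
   term here is the (i+1)-st one of the algorithm, while [proximal_point i] is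
   its i-th iterate, starting with x0. *)
Fixpoint proximal_point (R : realType) (H : metricType R) (S : Type)
    (f : H -> S -> \bar R) (lambda : nat -> R) (xi : nat -> S) (x0 : H)
    (i : nat) : H :=
  if i is j.+1 then
    resolvent (f ^~ (xi j)) (lambda j) (proximal_point f lambda xi x0 j)
  else x0.

Definition independent_RVs (R : realType) (d d' : measure_display)
    (Omega : measurableType d) (S : measurableType d')
    (P : probability Omega R) (xi : nat -> {RV P >-> S}) : Prop :=
  forall (J : {fset nat}) (A : nat -> set S),
    (forall i, i \in J -> measurable (A i)) ->
    (P (\bigcap_(i in [set` J]) (xi i @^-1` A i)) =
     \prod_(i <- J) P (xi i @^-1` A i))%E.

Definition borel (H : ptopologicalType) := g_sigma_algebraType (@open H).

(* Main.v *)
Require Import Defs.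
From mathcomp Require Import all_boot all_order all_algebra.
From mathcomp Require Import all_classical all_reals all_analysis.
From mathcomp Require Import measurable_realfun.
From mathcomp Require Import finmap lra ring.

(** Fix a minimizer [z] of [F] and let [V n] be the squared distance from the
    [n]-th iterate to [z]. Comparing the new iterate with [z] along a geodesic
    ([resolvent_three_point]), and using the growth condition to return from the
    new iterate to the old one, gives
      [V n.+1 <= V n - 2 * lambda n * (f (x n) (xi n) - f z (xi n))
         + C * lambda n ^+ 2 * L (xi n) ^+ 2 * (1 + V n)].
    Given the past, the difference of values has mean [F (x n) - F z >= 0], so
    [V] decreases on average up to summable errors.

    The usual conclusion is by convergence of almost supermartingales. Here it is
    replaced by passing to [ln (1 + V n)]: by concavity of the logarithm, the
    inequality gets divided by [1 + V n], after which the deviation of the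
    difference of values from its mean is bounded by a fixed multiple of
    [L (xi n)] plus a constant. Multiplied by [lambda n], these deviations are
    martingale differences with summable variances, so their sum converges almost
    surely by Kolmogorov's maximal inequality ([martingale_ae_cvg]). What remains
    is the deterministic [perturbed_decrease_cvg], which shows that [V n]
    converges and that the series of [lambda n * (F (x n) - F z)] is bounded
    ([ae_quasi_descent]).

    Since the sum of [lambda] is infinite, [F (x n)] comes arbitrarily close to
    its minimum along a subsequence. That subsequence is bounded, and closed balls
    are compact ([compact_cball]), so it has a cluster point, which is a minimizer.
    As the distances to all points of a countable dense set of minimizers
    converge, the whole sequence converges to it ([cluster_cvg]).

    The martingale property rests on the iterates being measurable with respect to
    the sigma-algebra generated by the previous [xi i] ([argmin_measurable]),
    which is independent of [xi n] ([past_indep]), so that integration over [xi n]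
    with the past frozen is legitimate ([freezing]). *)

Set Implicit Arguments.
Unset Strict Implicit.
Unset Printing Implicit Defensive.

Import Order.TTheory GRing.Theory Num.Theory.
Import numFieldNormedType.Exports.

Local Open Scope classical_set_scope.
Local Open Scope ring_scope.

(** * Bounded closed sets of a locally compact Hadamard space *)

Section MetricBasics.
Context {R : realType} {H : metricType R}.
Implicit Types x y z : H.

Lemma ler_dist_mdist x y z : `|mdist x y - mdist x z| <= mdist y z.
Proof.
have := metric_triangle x y z; have := metric_triangle x z y.
by rewrite (metric_sym z y) ler_norml => ? ?; apply/andP; split; lra.
Qed.

Lemma mdist_continuous x : continuous (mdist x : H -> R).
Proof.
move=> y; apply/cvgrPdist_lt => e e0; near=> z.
apply: le_lt_trans (ler_dist_mdist x y z) _.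
suff : ball y e z by rewrite ballEmdist.
by near: z; exact: nbhsx_ballx.
Unshelve. all: by end_near. Qed.

Definition cball x (r : R) : set H := [set y | mdist x y <= r].

Lemma closed_cball x r : closed (cball x r).
Proof.
rewrite (_ : cball x r = mdist x @^-1` [set t | t <= r]); last by [].
by apply: closed_comp (@closed_le _ r) => y _; exact: mdist_continuous.
Qed.

End MetricBasics.

Section HopfRinow.
Context {R : realType} {H : completeMetricType R}.
Implicit Types x y z : H.

Lemma compact_seq_cover (A : set H) (r : H -> R) : compact A ->
  (forall x, 0 < r x) ->
  exists s : seq H, forall y, A y -> exists2 c, c \in s & mdist c y < r c.
Proof.
rewrite compact_cover => cA r0.
have [||D _ AD] := cA H setT (fun x => (ball x (r x))°).
- by move=> i _; exact: open_interior.
- move=> y Ay; exists y => //; rewrite /interior /=.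
  exact: nbhsx_ballx.
exists (enum_fset D) => y /AD[c /= cD /interior_subset].
by rewrite ballEmdist => cy; exists c.
Qed.

(** This turns total boundedness into the Cauchy property of ultrafilters. *)
Lemma ultra_seq_cover (F : set_system H) (s : seq H) (r : R) :
  UltraFilter F ->
  F [set y | exists2 c, c \in s & mdist c y < r] ->
  exists c, F [set y | mdist c y < r].
Proof.
move=> FU; elim: s => [|a s IH] Fs.
  by have /filter_ex[y [c]] := Fs; rewrite in_nil.
have [Fa|Fa] := in_ultra_setVsetC [set y | mdist a y < r] FU; first by exists a.
apply: IH; apply: filterS (filterI Fs Fa) => y [[c]] + cy /= ay.
by rewrite inE => /orP[/eqP ca|cs]; [rewrite ca in cy|exists c].
Qed.

Lemma totally_bounded_compact (A : set H) : closed A ->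
  (forall e : R, 0 < e -> exists s : seq H,
     forall y, A y -> exists2 c, c \in s & mdist c y < e) ->
  compact A.
Proof.
move=> clA tb; rewrite compact_ultra => F FU FA.
have Fcvg : cvg F.
  apply: cauchy_cvg; apply: cauchy_exP => e e0.
  have [s sA] := tb e e0.
  have [|c Fc] := @ultra_seq_cover F s e FU.
    by apply: filterS FA => y /sA.
  by exists c; rewrite ballEmdist.
exists (lim F); split => //=.
by apply: (closed_cvg _ clA) Fcvg.
Qed.

(** Where the geometry enters: a ball of radius [r + e] stays within [e] of the
    ball of radius [r], as one sees by stopping on a geodesic at distance
    [r]. *)
Lemma geodesic_point_near x y (r e : R) : hadamard H ->
  0 <= r -> 0 < e -> mdist x y <= r + e ->
  exists2 z, mdist x z <= r & mdist z y <= e.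
Proof.
move=> [geo _] r0 e0 xy.
have [xyr|rxy] := leP (mdist x y) r.
  by exists y => //; rewrite mdistxx ltW.
have [g [gg g0 g1]] := geo x y.
have d0 : 0 < mdist x y by exact: le_lt_trans rxy.
have t01 : 0 <= r / mdist x y <= 1.
  by apply/andP; split; [rewrite divr_ge0// ltW|rewrite ler_pdivrMr// mul1r ltW].
have o01 : 0 <= (1 : R) <= 1 by rewrite ler01 lexx.
have z01 : 0 <= (0 : R) <= 1 by rewrite ler01 lexx.
exists (g (r / mdist x y)).
  rewrite -{1}g0 (gg _ _ z01 t01) g0 g1 sub0r normrN ger0_norm; last by case/andP: t01.
  by rewrite mulrCA divff ?gt_eqF// mulr1.
rewrite -{2}g1 (gg _ _ t01 o01) g0 g1 distrC ger0_norm; last by rewrite subr_ge0; case/andP: t01.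
rewrite mulrBr mulr1 mulrCA divff ?gt_eqF// mulr1; lra.
Qed.

Lemma small_compact_cball : locally_compact [set: H] ->
  exists r : H -> R, forall x, 0 < r x /\ compact (cball x (r x)).
Proof.
move=> lc.
suff /choice[r rP] : forall x : H, exists r : R, 0 < r /\ compact (cball x r) by exists r.
move=> x; have [U] := lc x I.
move=> wU [cU _]; have /nbhs_ballP[e /= e0 eU] : nbhs x U.
  by move: wU; rewrite /within/=; apply: filterS => y; exact.
exists (e / 2); split; first by rewrite divr_gt0.
apply: (subclosed_compact _ cU); first exact: closed_cball.
move=> y xy; apply: eU; rewrite ballEmdist /=; apply: le_lt_trans xy _.
by rewrite ltr_pdivrMr// ltr_pMr// ltr1n.
Qed.

(** Hopf-Rinow: the radii [t] for which [cball x t] is compact form an interval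
    starting at 0. Geodesics make it closed, since a point at distance at most
    [s] is close to the ball of any radius slightly below [s], whence total
    boundedness. They also make it open, since the ball of radius [s + d] lies
    within [d] of the compact ball of radius [s], which finitely many small
    compact balls cover with some margin. *)
Lemma compact_cball x r : hadamard H -> locally_compact [set: H] ->
  compact (cball x r).
Proof.
move=> hadH lcH.
have cball_le s t : s <= t -> compact (cball x t) -> compact (cball x s).
  move=> st ct; apply: (subclosed_compact _ ct); first exact: closed_cball.
  by move=> y xy; exact: le_trans st.
pose A := [set t : R | 0 <= t /\ compact (cball x t)].
have A0 : A 0.
  split => //; suff -> : cball x 0 = [set x] by exact: compact_set1.
  apply/seteqP; split => y; last by move=> ->; rewrite /cball/= mdistxx.
  move=> xy; apply/esym/mdist_positivity/eqP.
  by rewrite eq_le mdist_ge0 andbT.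
apply: contrapT => nc.
have ubA : ubound A r.
  move=> t [t0 ct]; rewrite leNgt; apply/negP => rt.
  by apply: nc; apply: cball_le ct; exact: ltW.
have supA : has_sup A by split; [exists 0|exists r].
pose s := sup A.
have s0 : 0 <= s by apply: sup_upper_bound.
(* closedness of the interval of good radii *)
have cs : compact (cball x s).
  apply: totally_bounded_compact; first exact: closed_cball.
  move=> e e0; have e20 : 0 < e / 2 by rewrite divr_gt0.
  have [t [t0 ct] st] := sup_adherent e20 supA.
  have [c cP] := @compact_seq_cover _ (fun=> e / 2) ct (fun=> e20).
  exists c => y xy.
  have [z xz zy] := @geodesic_point_near x y t (e / 2) hadH t0 e20 ltac:(rewrite /s /cball/= in xy *; lra).
  have [k kc kz] := cP z xz; exists k => //.
  by have := metric_triangle k z y; lra.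
(* openness: [d] is the margin left by the finite cover with halved radii *)
have [rho rhoP] := small_compact_cball lcH.
have rho20 y : 0 < rho y / 2 by rewrite divr_gt0// (rhoP y).1.
have [c cP] := @compact_seq_cover _ (fun y => rho y / 2) cs rho20.
pose d := \big[Num.min/1]_(y <- c) (rho y / 2).
have d0 : 0 < d by rewrite lt_bigmin// ltr01; apply/allP => y _ /=.
have dle y : y \in c -> d <= rho y / 2.
  by move=> yc; exact: ge_bigmin_seq.
have : A (s + d).
  split; first by rewrite addr_ge0// ltW.
  have cU : compact (\big[setU/set0]_(y <- c) cball y (rho y)).
    by apply: bigsetU_compact => y _; exact: (rhoP y).2.
  apply: (subclosed_compact _ cU); first exact: closed_cball.
  move=> y xy.
  have [z xz zy] := @geodesic_point_near x y s d hadH s0 d0 xy.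
  have [k kc kz] := cP z xz.
  rewrite -bigcup_seq; exists k => //=; rewrite /cball/=.
  have := metric_triangle k z y; have := dle _ kc; lra.
by move/(sup_upper_bound supA); rewrite -/s; lra.
Qed.

(** The space is the union of the balls [cball point n], each of which has a
    finite net of mesh [n.+1%:R^-1]; the sequence lists all these nets. *)
Lemma dense_sequence : hadamard H -> locally_compact [set: H] ->
  exists q : nat -> H, forall y (e : R), 0 < e -> exists n, mdist (q n) y < e.
Proof.
move=> hadH lcH.
have : forall n : nat, exists s : seq H,
    forall y, mdist point y <= n%:R -> exists2 c, c \in s & mdist c y < n.+1%:R^-1.
  move=> n; apply: (@compact_seq_cover (cball point n%:R) (fun=> n.+1%:R^-1)) => //.
  exact: compact_cball.
move=> /choice[s sP].
pose q k := if @choice.unpickle (nat * nat)%type k is Some nj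
  then nth point (s nj.1) nj.2 else point : H.
exists q => y e e0.
have [N1 N1P] : exists n : nat, mdist point y <= n%:R.
  by exists (Num.truncn (mdist point y)).+1; apply/ltW/truncnS_gt.
have [N2 _ N2P] := near_infty_natSinv_lt (PosNum e0).
pose n := maxn N1 N2.
have N1n : (N1%:R : R) <= n%:R by rewrite ler_nat leq_maxl.
have [c cs cy] := sP n y (le_trans N1P N1n).
exists (choice.pickle (n, index c (s n))).
rewrite /q choice.pickleK /= nth_index//; apply: lt_trans cy _.
by have := N2P n (leq_maxr _ _).
Qed.

End HopfRinow.

(** * The resolvent *)

Section Growth.
Context {R : realType} {H : completeMetricType R}.
Variables (h : H -> R) (K : R) (p : H).
Hypothesis K0 : 0 <= K.
Hypothesis hK : forall x y, h x - h y <= K * (1 + mdist x p) * mdist x y.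

Lemma growth_lipschitz x y : mdist x y <= 1 ->
  `|h x - h y| <= K * (2 + mdist x p) * mdist x y.
Proof.
move=> xy1; have := hK x y; have := hK y x; rewrite (metric_sym y x).
have d0 := mdist_ge0 x y.
have yp : mdist y p <= 1 + mdist x p.
  by have := metric_triangle y x p; rewrite (metric_sym y x); lra.
have : K * (1 + mdist y p) * mdist x y <= K * (2 + mdist x p) * mdist x y.
  by rewrite ler_wpM2r// ler_wpM2l//; lra.
have : K * (1 + mdist x p) * mdist x y <= K * (2 + mdist x p) * mdist x y.
  by rewrite ler_wpM2r// ler_wpM2l//; lra.
by move=> ? ? ? ?; rewrite ler_norml; apply/andP; split; lra.
Qed.

Lemma growth_continuous : continuous h.
Proof.
move=> x; apply/cvgrPdist_lt => e e0.
pose M := K * (2 + mdist x p) + 1.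
have M0 : 0 < M.
  by rewrite ltr_wpDl// mulr_ge0// addr_ge0// mdist_ge0.
near=> z.
have xz : mdist x z < Num.min 1 (e / M).
  suff : ball x (Num.min 1 (e / M)) z by rewrite ballEmdist.
  by near: z; apply: nbhsx_ballx; rewrite lt_min ltr01 divr_gt0.
move: xz; rewrite lt_min => /andP[z1 z2].
apply: le_lt_trans (growth_lipschitz (ltW z1)) _.
rewrite ltr_pdivlMr// in z2.
apply: le_lt_trans _ z2; rewrite mulrC ler_wpM2l ?mdist_ge0// /M; lra.
Unshelve. all: by end_near. Qed.

End Growth.

Section Resolvent.
Context {R : realType} {H : completeMetricType R}.
Hypothesis hadH : hadamard H.
Hypothesis lcH : locally_compact [set: H].
Variables (h : H -> R) (K : R) (p : H).
Hypothesis K0 : 0 <= K.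
Hypothesis hK : forall x y, h x - h y <= K * (1 + mdist x p) * mdist x y.
Hypothesis hcvx : forall (g : R -> H) (t : R), geodesic g -> 0 <= t <= 1 ->
  h (g t) <= (1 - t) * h (g 0) + t * h (g 1).
Variables (lam : R) (x : H).
Hypothesis lam0 : 0 < lam.

Let phi (y : H) := h y + (2 * lam)^-1 * mdist x y ^+ 2.
Let J := resolvent (EFin \o h) lam x.

Let lam20 : 0 < 2 * lam. Proof. by rewrite mulr_gt0. Qed.

Let phi_continuous : continuous phi.
Proof.
move=> y; apply: cvgD; first exact: (growth_continuous K0 hK).
apply: cvgMr; rewrite expr2.
by apply: cvgM; exact: mdist_continuous.
Qed.

Let phi_has_min : exists c, forall y, phi c <= phi y.
Proof.
pose r := 2 * lam * (K * (1 + mdist x p)).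
have p0 := mdist_ge0 x p.
have r0 : 0 <= r by rewrite !mulr_ge0// ?ltW//; lra.
have := @compact_EVT_min H R phi (cball x r) _ (@compact_cball _ _ x r hadH lcH).
case.
- by exists x; rewrite /cball/= mdistxx.
- by apply: continuous_subspaceT => y; exact: phi_continuous.
move=> c _ cP; exists c => y.
have [yr|ry] := leP (mdist x y) r; first exact/cP/mem_set.
have cx : phi c <= phi x by apply/cP/mem_set; rewrite /cball/= mdistxx.
apply: le_trans cx _; rewrite /phi mdistxx expr0n mulr0 addr0.
have hxy := hK x y.
suff : K * (1 + mdist x p) * mdist x y <= (2 * lam)^-1 * mdist x y ^+ 2 by lra.
rewrite expr2 mulrA ler_wpM2r ?mdist_ge0//.
by rewrite ler_pdivlMl// -/r ltW.
Qed.

(** The growth condition makes the quadratic term win outside of the ball of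
    radius [2 * lam * K * (1 + mdist x p)], so that the minimum over that
    compact ball is a global one. *)
Lemma resolvent_minimizes y : phi J <= phi y.
Proof.
have [c cP] := phi_has_min.
pose psi y := ((EFin \o h) y + ((2 * lam)^-1 * mdist x y ^+ 2)%:E)%E.
have psiE z : psi z = (phi z)%:E by rewrite /psi /phi EFinD.
have infE : ereal_inf (range psi) = (phi c)%:E.
  apply/eqP; rewrite eq_le; apply/andP; split.
    by apply: ereal_inf_lbound; exists c.
  by apply: le_ereal_inf_tmp => _ [z _ <-]; rewrite psiE lee_fin.
have /(xgetPex x) : exists z, minimizers psi z.
  by exists c; split; rewrite infE.
rewrite -[xget _ _]/J => -[_]; rewrite infE psiE => -[->].
exact: cP.
Qed.

(** The squared distance is 2-strongly convex in a Hadamard space. Comparing the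
    value at the minimizer with the value at time [t] of the geodesic to [y],
    dividing by [t] and letting [t] tend to 0 gives quadratic growth around the
    minimizer. *)
Lemma resolvent_strongly_minimizes y :
  (2 * lam)^-1 * mdist J y ^+ 2 <= phi y - phi J.
Proof.
have [g [gg g0 g1]] := hadH.1 J y.
set c := (2 * lam)^-1; have c0 : 0 < c by rewrite invr_gt0.
set D := mdist J y ^+ 2; have D0 : 0 <= D by rewrite exprn_ge0// mdist_ge0.
have key t : 0 < t -> t <= 1 -> (1 - t) * (c * D) <= phi y - phi J.
  move=> t0 t1; have t01 : 0 <= t <= 1 by rewrite ltW.
  have h1 := hcvx gg t01; have h2 := hadH.2 x g t gg t01.
  have h3 := resolvent_minimizes (g t).
  rewrite g0 g1 in h1 h2; rewrite -/D in h2.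
  have h4 : c * mdist x (g t) ^+ 2 <= c * ((1 - t) * mdist x J ^+ 2 +
     t * mdist x y ^+ 2 - t * (1 - t) * D) by rewrite ler_wpM2l// ltW.
  rewrite -(ler_pM2l t0); move: h3; rewrite /phi -/c; nra.
apply/ler_addgt0Pr => e e0.
(* at this [t] the loss [t * (c * D)] is at most [e] *)
pose t := Num.min 1 (e / (c * D + 1)).
have cD0 : 0 < c * D + 1 by rewrite ltr_wpDl// mulr_ge0// ltW.
have t0 : 0 < t by rewrite lt_min ltr01 divr_gt0.
have t1 : t <= 1 by rewrite ge_min lexx.
have := key t t0 t1.
have : t * (c * D + 1) <= e by rewrite -ler_pdivlMr// ge_min lexx orbT.
nra.
Qed.

Lemma resolvent_three_point y :
  mdist J y ^+ 2 <= mdist x y ^+ 2 - mdist x J ^+ 2 - 2 * lam * (h J - h y).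
Proof.
have := resolvent_strongly_minimizes y; rewrite /phi.
rewrite ler_pdivrMl// => h1; apply: le_trans h1 _.
rewrite mulrBr !mulrDr !mulrA divff ?gt_eqF// !mul1r; lra.
Qed.

End Resolvent.

(** * Measurability of maps into a separable metric space *)

Section MeasurableApproximation.
Context {d : measure_display} {T : measurableType d} {R : realType}.

Lemma measurable_fun_gt (Y : T -> R) :
  (forall c, measurable [set t | c < Y t]) -> measurable_fun setT Y.
Proof.
move=> mY; apply: (measurability _ (RGenOInfty.measurableE R)) => //.
move=> _ [_ [c ->] <-]; rewrite setTI.
by rewrite (_ : _ @^-1` _ = [set t | c < Y t])//; apply/seteqP; split => t /=;
  rewrite in_itv/= andbT.
Qed.

Lemma measurable_fun_lt (Y : T -> R) :
  (forall c, measurable [set t | Y t < c]) -> measurable_fun setT Y.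
Proof.
move=> mY; apply: (measurability _ (RGenInftyO.measurableE R)) => //.
move=> _ [_ [c ->] <-]; rewrite setTI.
by rewrite (_ : _ @^-1` _ = [set t | Y t < c])//; apply/seteqP; split => t /=;
  rewrite in_itv.
Qed.

Lemma measurable_ge_set (Y : T -> R) c : measurable_fun setT Y ->
  measurable [set t | c <= Y t].
Proof.
move=> /(_ measurableT `[c, +oo[%classic (measurable_itv _)); rewrite setTI.
by rewrite (_ : _ @^-1` _ = [set t | c <= Y t])//; apply/seteqP; split => t /=;
  rewrite in_itv/= andbT.
Qed.

Lemma measurable_lt_set (Y : T -> R) c : measurable_fun setT Y ->
  measurable [set t | Y t < c].
Proof.
move=> /(_ measurableT `]-oo, c[%classic (measurable_itv _)); rewrite setTI.
by rewrite (_ : _ @^-1` _ = [set t | Y t < c])//; apply/seteqP; split => t /=;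
  rewrite in_itv/=.
Qed.

(** Scheme for the measurability of a quantity [Y t] attached to a point of a
    separable space depending on [t]: [a j t] measures how far the [j]-th point
    of a dense sequence is from that point, and [b j t] is the value there. Then
    [c < Y t] can be said with countable quantifiers: for some [m] and [n], every
    [j] with [a j t < n.+1%:R^-1] has [c + m.+1%:R^-1 <= b j t]. *)
Lemma measurable_fun_approx (a b : nat -> T -> R) (Y : T -> R) :
  (forall j, measurable_fun setT (a j)) ->
  (forall j, measurable_fun setT (b j)) ->
  (forall t (e : R), 0 < e -> exists2 dl : R, 0 < dl &
     forall j, a j t < dl -> `|b j t - Y t| < e) ->
  (forall t (dl : R), 0 < dl -> exists j, a j t < dl) ->
  measurable_fun setT Y.
Proof.
move=> ma mb abY a0; apply: measurable_fun_gt => c.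
pose B m n j := [set t | n.+1%:R^-1 <= a j t] `|`
                [set t | c + m.+1%:R^-1 <= b j t].
rewrite (_ : [set _ | _] = \bigcup_m \bigcup_n \bigcap_j B m n j).
  do 2 (apply: bigcupT_measurable => ?); apply: bigcapT_measurable => j.
  by apply: measurableU; exact: measurable_ge_set.
apply/seteqP; split => t /=.
  move=> cY; have e0 : 0 < (Y t - c) / 2 by rewrite divr_gt0// subr_gt0.
  have [dl dl0 dlP] := abY t _ e0.
  have [m _ mP] := near_infty_natSinv_lt (PosNum e0).
  have [n _ nP] := near_infty_natSinv_lt (PosNum dl0).
  exists m => //; exists n => // j _.
  have [/dlP ajt|ajt] := ltP (a j t) dl.
    right => /=; have := mP m (leqnn m); rewrite /=; set i := _^-1.
    by clearbody i; move: ajt; rewrite ltr_norml => /andP[? ?] ?; lra.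
  left => /=; apply: le_trans ajt; exact/ltW/(nP n (leqnn n)).
move=> [m _ [n _ BP]].
have e0 : (0 : R) < m.+1%:R^-1 by rewrite invr_gt0.
have [dl dl0 dlP] := abY t _ e0.
have min0 : 0 < Num.min dl n.+1%:R^-1 by rewrite lt_min dl0 invr_gt0 ltr0Sn.
have [j] := a0 t _ min0.
rewrite lt_min => /andP[/dlP + ajn].
rewrite ltr_norml => /andP[_ bY].
have [/=|/=] := BP j I; first by rewrite leNgt ajn.
by move: bY; move: (m.+1%:R^-1) => i; lra.
Qed.

End MeasurableApproximation.

(** Measurability of an [H]-valued map through its real-valued distances to fixed
    points. On a separable space this is Borel measurability, but it makes sense
    for any sigma-algebra on the domain and passes to limits at once. *)
Definition dist_measurable {d : measure_display} {T : measurableType d}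
    {R : realType} {H : metricType R} (X : T -> H) :=
  forall y, measurable_fun [set: T] (fun t => mdist y (X t)).

Section DistMeasurable.
Context {R : realType} {H : completeMetricType R}.
Variable q : nat -> H.
Hypothesis qdense : forall y (e : R), 0 < e -> exists n, mdist (q n) y < e.
Context {d : measure_display} {T : measurableType d}.

Lemma continuous_mdist_lt (h : H -> R) y (e : R) : continuous h -> 0 < e ->
  exists2 dl : R, 0 < dl & forall z, mdist y z < dl -> `|h y - h z| < e.
Proof.
move=> ch e0; have /cvgrPdist_lt/(_ e e0)/nbhs_ballP[dl /= dl0 dlP] := ch y.
by exists dl => // z yz; apply: dlP; rewrite ballEmdist.
Qed.

Lemma measurable_fun_caratheodory (X : T -> H) (g : H -> T -> R) :
  dist_measurable X -> (forall y, measurable_fun setT (g y)) ->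
  (forall t, continuous (g ^~ t)) -> measurable_fun setT (fun t => g (X t) t).
Proof.
move=> mX mg cg.
apply: (@measurable_fun_approx _ _ _ (fun j t => mdist (q j) (X t))
  (fun j => g (q j))) => //.
- move=> t e e0; have [dl dl0 dlP] := continuous_mdist_lt (X t) (cg t) e0.
  by exists dl => // j qj; rewrite distrC; apply: dlP; rewrite metric_sym.
- by move=> t dl dl0; exact: qdense.
Qed.

(** The infimum of [phi ^~ t] can be taken over the dense sequence, hence is
    measurable in [t]; points with almost minimal value are close to the
    minimizer by quadratic growth. *)
Lemma argmin_measurable (J : T -> H) (phi : H -> T -> R) (c : R) : 0 < c ->
  (forall y, measurable_fun setT (phi y)) -> (forall t, continuous (phi ^~ t)) ->
  (forall t y, c * mdist (J t) y ^+ 2 <= phi y t - phi (J t) t) ->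
  dist_measurable J.
Proof.
move=> c0 mphi cphi Jmin.
pose m t := phi (J t) t.
have near_min t (dl : R) : 0 < dl -> exists j, phi (q j) t - m t < dl.
  move=> dl0; have [e e0 eP] := continuous_mdist_lt (J t) (cphi t) dl0.
  have [j qj] := qdense (J t) e0; exists j.
  have := eP (q j) ltac:(by rewrite metric_sym).
  by rewrite ltr_norml /m => /andP[? ?]; lra.
have mm : measurable_fun setT m.
  apply: measurable_fun_lt => r.
  rewrite (_ : [set _ | _] = \bigcup_j [set t | phi (q j) t < r]).
    by apply: bigcupT_measurable => j; exact: measurable_lt_set.
  apply/seteqP; split => t /=.
    by rewrite -subr_gt0 => /(near_min t)[j qj]; exists j => //=; lra.
  move=> [j _ /= qj]; apply: le_lt_trans qj; rewrite -subr_ge0.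
  by rewrite (le_trans _ (Jmin t (q j)))// mulr_ge0 ?exprn_even_ge0// ltW.
move=> y.
apply: (@measurable_fun_approx _ _ _ (fun j t => phi (q j) t - m t)
  (fun j t => mdist y (q j))) => //.
- by move=> j; apply: measurable_funB.
- move=> t e e0; exists (c * e ^+ 2) => [|j qj].
    by rewrite mulr_gt0// exprn_gt0.
  apply: le_lt_trans (ler_dist_mdist _ _ _) _; rewrite metric_sym.
  have := le_lt_trans (Jmin t (q j)) qj; rewrite ltr_pM2l// => h.
  by rewrite -(@ltr_pXn2r _ 2) ?nnegrE ?mdist_ge0 ?ltW.
Qed.

Lemma dist_measurable_cvg (X : nat -> T -> H) (Y : T -> H) :
  (forall n, dist_measurable (X n)) ->
  (forall t, X n t @[n --> \oo] --> Y t) -> dist_measurable Y.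
Proof.
move=> mX XY y; apply: (@measurable_fun_cvg _ _ _ _ (fun n t => mdist y (X n t))).
  by move=> n; exact: mX.
move=> t _; apply: (@cvg_comp _ _ _ (fun n => X n t) (mdist y) _ _ _ (XY t)).
exact: mdist_continuous.
Qed.

Lemma dist_measurable_borel (X : T -> H) : dist_measurable X ->
  measurable_fun [set: T] (X : T -> borel H).
Proof.
move=> mX; apply: (@measurability _ _ T (borel H) setT X (@open H)) => // _ [U oU <-].
rewrite setTI.
pose A j k := [set t | mdist (q j) (X t) < k.+1%:R^-1].
rewrite (_ : X @^-1` U = \bigcup_j \bigcup_k
   if pselect (forall y, mdist (q j) y < k.+1%:R^-1 -> U y) then A j k else set0).
  apply: bigcupT_measurable => j; apply: bigcupT_measurable => k.
  case: pselect => _ /=; last exact: measurable0.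
  exact: (@measurable_lt_set _ _ _ (fun t => mdist (q j) (X t))).
apply/seteqP; split => t /=.
  move=> UX; have /nbhs_ballP[e /= e0 eU] : nbhs (X t) U.
    by move: oU; rewrite openE => /(_ _ UX).
  have e20 : 0 < e / 2 by rewrite divr_gt0.
  have [k _ kP] := near_infty_natSinv_lt (PosNum e20).
  have k0 : (0 : R) < k.+1%:R^-1 by rewrite invr_gt0.
  have [j qj] := qdense (X t) k0.
  exists j => //; exists k => //; case: pselect => //; case=> y jy.
  apply: eU; rewrite ballEmdist/=.
  have := kP k (leqnn k); rewrite /=; move: qj jy; move: (k.+1%:R^-1) => i qj jy ki.
  by have := metric_triangle (X t) (q j) y; rewrite (metric_sym (X t) (q j)); lra.
by move=> [j _ [k _]]; case: pselect => //= h; exact: h.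
Qed.

End DistMeasurable.

(** * Deterministic sequences *)

Section RealSequences.
Context {R : realType}.
Implicit Types (u : nat -> R).

Lemma cvgn_le_bound u : cvgn u -> exists M : R, forall n, `|u n| <= M.
Proof.
move=> /cvg_seq_bounded[M [_ MP]]; exists (M + 1) => n.
by apply: MP; [lra|].
Qed.

Lemma nneseries_lty_cvgn u : (forall n, 0 <= u n) ->
  (\sum_(0 <= i <oo) (u i)%:E < +oo)%E -> cvgn (series u).
Proof.
move=> u0 ufin.
have s0 : (0 <= \sum_(0 <= i <oo) (u i)%:E)%E.
  by apply: nneseries_ge0 => n _ _; rewrite lee_fin.
apply: nondecreasing_is_cvgn.
  by apply: nondecreasing_series.
exists (fine (\sum_(0 <= i <oo) (u i)%:E)%E) => _ [n _ <-].
rewrite -lee_fin fineK ?ge0_fin_numE// seriesEnat/= -sumEFin.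
by apply: nneseries_lim_ge => k _ _; rewrite lee_fin.
Qed.

Lemma nneseries_y_unbounded u : (forall n, 0 <= u n) ->
  (\sum_(0 <= i <oo) (u i)%:E = +oo)%E -> forall M, exists n, M < series u n.
Proof.
move=> u0 uy M; apply: contrapT => nM.
suff : (\sum_(0 <= i <oo) (u i)%:E <= M%:E)%E by rewrite uy.
apply: lime_le; first by apply: is_cvg_nneseries => n _ _; rewrite lee_fin.
apply: nearW => n; rewrite sumEFin lee_fin leNgt; apply/negP => h.
by apply: nM; exists n; rewrite seriesEnat.
Qed.

Lemma series_tail u : (forall n, 0 <= u n) -> cvgn (series u) ->
  forall e, 0 < e -> exists N, forall k, \sum_(N <= i < N + k) u i <= e.
Proof.
move=> u0 uc e e0.
have /cvgrPdist_lt/(_ e e0)[N _ NP] := uc.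
exists N => k; have := NP N (leqnn N).
have : series u (N + k)%N <= limn (series u).
  by apply: nondecreasing_cvgn_le => //; exact: nondecreasing_series.
have := sub_series u N (N + k)%N; rewrite leq_addr => <-.
by rewrite ltr_norml => ? /andP[? ?]; lra.
Qed.

(** Once [series a] is added and the convergent sums of [m] and [b] are
    subtracted, [Y] becomes nonincreasing and stays bounded below. *)
Lemma perturbed_decrease_cvg (Y a m b : nat -> R) :
  (forall n, 0 <= Y n) -> (forall n, 0 <= a n) ->
  (forall n, Y n.+1 <= Y n - a n + m n + b n) ->
  cvgn (series m) -> cvgn (series b) ->
  cvgn Y /\ exists M, forall n, series a n <= M.
Proof.
move=> Y0 a0 step mc bc.
pose U n := Y n + series a n - series m n - series b n.
have sS w n : series w n.+1 = series w n + w n :> R.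
  by rewrite !seriesEnat/= big_nat_recr.
have a0s n : 0 <= series a n by rewrite seriesEnat/=; exact: sumr_ge0.
have [Mm MmP] := cvgn_le_bound mc; have [Mb MbP] := cvgn_le_bound bc.
have Uc : cvgn U.
  apply: nonincreasing_is_cvgn.
    by apply/nonincreasing_seqP => n; rewrite /U !sS; have := step n; lra.
  exists (- Mm - Mb) => _ [n _ <-]; rewrite /U.
  have := MmP n; have := MbP n; have := Y0 n; have := a0s n.
  by rewrite !ler_norml => ? ? /andP[? ?] /andP[? ?]; lra.
pose W n := Y n + series a n.
have Wc : cvgn W.
  rewrite (_ : W = U \+ series m \+ series b); last first.
    by apply/funext => n /=; rewrite /U /W; lra.
  by apply: is_cvgD => //; exact: is_cvgD.
have [MW MWP] := cvgn_le_bound Wc.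
have aM n : series a n <= MW.
  by have := MWP n; have := Y0 n; rewrite /W ler_norml => ? /andP[? ?]; lra.
split; last by exists MW.
have ac : cvgn (series a).
  apply: nondecreasing_is_cvgn; first exact: nondecreasing_series.
  by exists MW => _ [n _ <-].
rewrite (_ : Y = W \- series a); last by apply/funext => n /=; rewrite /W; lra.
exact: is_cvgB.
Qed.

(** Concavity of the logarithm: the increment of [ln (1 + V)] is at most the
    relative increment of [1 + V]. *)
Lemma ln1D_step (V V' : R) : 0 <= V -> 0 <= V' ->
  ln (1 + V') <= ln (1 + V) + (V' - V) / (1 + V).
Proof.
move=> V0 V'0; have V10 : 0 < 1 + V by lra.
have V'10 : 0 < 1 + V' by lra.
have q0 : 0 < (1 + V') / (1 + V) by rewrite divr_gt0.
rewrite -lerBlDl -ln_div ?posrE//.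
have -> : (1 + V') / (1 + V) = 1 + (V' - V) / (1 + V).
  by field; rewrite gt_eqF.
apply: le_ln1Dx.
rewrite ltr_pdivlMr//; lra.
Qed.

Lemma ln1D_cvg (V : nat -> R) : (forall n, 0 <= V n) ->
  cvgn (fun n => ln (1 + V n)) -> cvgn V.
Proof.
move=> V0 lc.
rewrite (_ : V = fun n => expR (ln (1 + V n)) - 1); last first.
  apply/funext => n; rewrite lnK ?posrE; last by have := V0 n; lra.
  by rewrite addrC addKr.
apply: is_cvgB; last exact: is_cvg_cst.
apply: cvgP; apply: (@cvg_comp _ _ _ (fun n => ln (1 + V n)) expR _ _ _ lc).
exact: continuous_expR.
Qed.

End RealSequences.

Section ClusterPoints.
Context {R : realType} {H : completeMetricType R}.

(** The weights [lam] have infinite sum while the weighted sum of the [G (x n)]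
    stays bounded, so [G (x n)] comes arbitrarily close to 0 at arbitrarily late
    times; a cluster point of the corresponding subsequence is a zero of [G] by
    continuity. *)
Lemma small_value_cluster (K : set H) (x : nat -> H) (G : H -> R)
    (lam : nat -> R) (M : R) :
  compact K -> (forall n, K (x n)) -> continuous G -> (forall y, 0 <= G y) ->
  (forall n, 0 < lam n) -> (forall M, exists n, M < series lam n) ->
  (forall n, series (fun i => lam i * G (x i)) n <= M) ->
  exists xh, G xh = 0 /\
    forall e N, 0 < e -> exists2 n, (N <= n)%N & mdist xh (x n) < e.
Proof.
move=> cK Kx Gc G0 lam0 lamy GM.
have small (N : nat) : exists n, (N <= n)%N /\ G (x n) < N.+1%:R^-1.
  apply: contrapT => /forallNP nsmall.
  have e0 : (0 : R) < N.+1%:R^-1 by rewrite invr_gt0.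
  move: e0 nsmall; move: (N.+1%:R^-1) => e e0 nsmall.
  have Gge n : (N <= n)%N -> e <= G (x n).
    by move=> Nn; rewrite leNgt; apply/negP => h; apply: (nsmall n).
  have [n nP] := lamy (series lam N + M / e).
  have lamN k : (k <= N)%N -> series lam k <= series lam N.
    by move=> kN; apply: nondecreasing_series => // i _ _; exact: ltW.
  have M0 : 0 <= M by have := GM 0%N; rewrite seriesEnat/= big_geq.
  have Nn : (N <= n)%N.
    rewrite leqNgt; apply/negP => /ltnW /lamN.
    have : 0 <= M / e by rewrite divr_ge0// ltW.
    lra.
  have GN : 0 <= series (fun i => lam i * G (x i)) N.
    by rewrite seriesEnat/=; apply: sumr_ge0 => i _; rewrite mulr_ge0// ltW.
  have := GM n.
  have := sub_series (fun i => lam i * G (x i)) N n; rewrite Nn => h1.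
  have := sub_series lam N n; rewrite Nn => h2.
  have : e * \sum_(N <= k < n) lam k <= \sum_(N <= k < n) lam k * G (x k).
    rewrite mulr_sumr; apply: ler_sum_nat => i /andP[Ni _].
    by rewrite mulrC ler_wpM2l ?Gge// ltW.
  have : M < e * \sum_(N <= k < n) lam k.
    by rewrite -h2 -ltr_pdivrMl// mulrC; lra.
  by rewrite -h1; lra.
have [s sP] := choice small.
have PF : ProperFilter ((fun N => x (s N)) @ \oo) by exact: fmap_proper_filter.
have [|xh [_ clxh]] := cK _ PF _.
  by exists 0%N => // N _; exact: Kx.
have near_cl e N : 0 < e -> exists2 k, (N <= k)%N & mdist xh (x (s k)) < e.
  move=> e0; have [|y [[k Nk <-]]] := clxh ((fun k => x (s k)) @` [set k | (N <= k)%N])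
    (ball xh e) _ (nbhsx_ballx _ _ e0).
    by exists N => // k /= Nk; exists k.
  by rewrite ballEmdist => xk; exists k.
exists xh; split; last first.
  move=> e N e0; have [k Nk kP] := near_cl e N e0.
  by exists (s k) => //; apply: leq_trans (sP k).1.
apply/eqP; rewrite eq_le G0 andbT; apply/ler_addgt0Pr => e e0; rewrite add0r.
have e20 : 0 < e / 2 by rewrite divr_gt0.
have [dl dl0 dlP] := continuous_mdist_lt xh Gc e20.
have [N _ NP] := near_infty_natSinv_lt (PosNum e20).
have [k Nk /dlP] := near_cl dl N dl0.
have := (sP k).2; have := NP k Nk; rewrite /= ltr_norml.
move: (k.+1%:R^-1) => i ? ? /andP[? ?]; lra.
Qed.

(** Some [z j] is close to [xh], so the limit of [mdist (z j) (x n)] is small,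
    since it is small along a subsequence; then all late terms are close to
    [z j], hence to [xh]. *)
Lemma cluster_cvg (M : set H) (z : nat -> H) (x : nat -> H) (xh : H) : M xh ->
  (forall y e, M y -> 0 < e -> exists j, mdist (z j) y < e) ->
  (forall j, cvgn (fun n => mdist (z j) (x n))) ->
  (forall e N, 0 < e -> exists2 n, (N <= n)%N & mdist xh (x n) < e) ->
  x n @[n --> \oo] --> xh.
Proof.
move=> Mxh zd zc xcl; apply/metricType_numDomainType.cvgrPdist_lt => e e0.
have e80 : 0 < e / 8 by rewrite divr_gt0.
have [j zj] := zd xh _ Mxh e80.
have /cvgrPdist_lt/(_ _ e80)[N _ NP] := zc j.
have [n0 Nn0 xn0] := xcl _ N e80.
have := NP n0 Nn0; rewrite /= ltr_norml => /andP[l1 l2].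
exists N => // n /= Nn.
have := NP n Nn; rewrite /= ltr_norml => /andP[l3 l4].
have := metric_triangle xh (z j) (x n); have := metric_triangle (z j) xh (x n0).
by rewrite (metric_sym xh (z j)); lra.
Qed.

End ClusterPoints.

(** * Integrability and random series *)

Section IntegrableReal.
Context {d : measure_display} {S : measurableType d} {R : realType}
  (mu : probability S R).

Lemma fin_num_integral_integrable (h : S -> \bar R) : measurable_fun setT h ->
  (\int[mu]_s h s)%E \is a fin_num -> mu.-integrable setT h.
Proof.
move=> mh; rewrite integralE => fin.
have [p0 n0] : (\int[mu]_s h^\+%E s)%E \is a fin_num /\ (\int[mu]_s h^\-%E s)%E \is a fin_num.
  by move: fin; rewrite fin_numB => /andP[].
apply/integrableP; split => //.
have -> : (\int[mu]_s `|h s| = \int[mu]_s h^\+ s + \int[mu]_s h^\- s)%E.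
  under eq_integral do rewrite -/((abse \o h) _) fune_abse.
  rewrite ge0_integralD//; [exact: measurable_funepos|exact: measurable_funeneg].
by apply: lte_add_pinfty; rewrite ltey_eq ?p0 ?n0.
Qed.

Lemma integrable_sqr (Z : S -> R) : measurable_fun setT Z ->
  (\int[mu]_w (Z w ^+ 2)%:E < +oo)%E ->
  mu.-integrable setT (fun w => (Z w ^+ 2)%:E).
Proof.
move=> mZ iZ; apply/integrableP; split.
  by apply/measurable_EFinP; exact: measurable_funX.
under eq_integral do rewrite gee0_abs ?lee_fin ?sqr_ge0//.
exact: iZ.
Qed.

Lemma integrable_prod (Y Z : S -> R) : measurable_fun setT Y ->
  measurable_fun setT Z ->
  (\int[mu]_w (Y w ^+ 2)%:E < +oo)%E -> (\int[mu]_w (Z w ^+ 2)%:E < +oo)%E ->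
  mu.-integrable setT (fun w => (Y w * Z w)%:E).
Proof.
move=> mY mZ iY iZ.
have := integrableD measurableT (integrable_sqr mY iY) (integrable_sqr mZ iZ).
apply: le_integrable => //.
  by apply/measurable_EFinP; exact: measurable_funM.
move=> w _ /=; rewrite lee_fin normrM.
rewrite [leRHS]ger0_norm ?addr_ge0 ?sqr_ge0// -[Y w ^+ 2]real_normK ?num_real//.
rewrite -[Z w ^+ 2]real_normK ?num_real//.
by have := normr_ge0 (Y w); have := normr_ge0 (Z w); nra.
Qed.

Lemma integrable_of_sqr (L : S -> R) : measurable_fun setT L ->
  (\int[mu]_s (L s ^+ 2)%:E < +oo)%E -> mu.-integrable setT (EFin \o L).
Proof.
move=> mL iL.
have i1 : (\int[mu]_s ((cst 1 s : R) ^+ 2)%:E < +oo)%E.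
  under eq_integral do rewrite expr1n.
  by rewrite integral_cst// mul1e; apply: le_lt_trans (ltry 1); exact: probability_le1.
have := integrable_prod mL (measurable_cst _) iL i1.
by under eq_fun do rewrite mulr1.
Qed.

End IntegrableReal.

Section AeSeries.
Context {d : measure_display} {T : measurableType d} {R : realType}
  (P : probability T R).

(** By monotone convergence the sum of the series has finite expectation, hence
    is almost surely finite. *)
Lemma ae_series_cvg (u : nat -> T -> R) (c : nat -> R) :
  (forall n w, 0 <= u n w) -> (forall n, measurable_fun setT (u n)) ->
  (forall n, (\int[P]_w (u n w)%:E <= (c n)%:E)%E) ->
  (\sum_(0 <= i <oo) (c i)%:E < +oo)%E ->
  {ae P, forall w, cvgn (series (fun n => u n w))}.
Proof.
move=> u0 mu uc cfin.
have fin : (\int[P]_w (\sum_(0 <= n <oo) (u n w)%:E) < +oo)%E.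
  rewrite integral_nneseries//.
  - apply: le_lt_trans cfin; apply: lee_nneseries => [n _ _|n _]; last exact: uc.
    by apply: integral_ge0 => w _; rewrite lee_fin.
  - by move=> n; exact/measurable_EFinP.
  - by move=> n w _; rewrite lee_fin.
have s0 w : (0 <= \sum_(0 <= n <oo) (u n w)%:E)%E.
  by apply: nneseries_ge0 => n _ _; rewrite lee_fin.
have int : P.-integrable setT (fun w => \sum_(0 <= n <oo) (u n w)%:E)%E.
  apply/integrableP; split.
    apply: ge0_emeasurable_sum => [n w _ _|n _]; first by rewrite lee_fin.
    exact/measurable_EFinP.
  by under eq_integral do rewrite gee0_abs//.
have := integrable_ae measurableT int; apply: filterS => w /(_ I) wfin.
by apply: nneseries_lty_cvgn => //; rewrite ltey_eq wfin.
Qed.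

End AeSeries.

(** * Almost sure convergence of square-summable martingales *)

Section Martingale.
Context {d : measure_display} {T : measurableType d} {R : realType}
  (P : probability T R).
Variable G : nat -> set (set T).
Hypothesis G_measurable : forall n, G n `<=` measurable.
Hypothesis G_mono : forall n, G n `<=` <<s G n.+1 >>.

(** The value of [Z] is determined by the events of [G n], that is, by what is
    observed before time [n]. *)
Definition adapted n (Z : T -> R) :=
  measurable_fun [set: g_sigma_algebraType (G n)] (Z : g_sigma_algebraType (G n) -> R).

Lemma g_sigma_measurable n (A : set T) : <<s G n >> A -> measurable A.
Proof.
move: A; apply: smallest_sub; last exact: G_measurable.
exact: sigma_algebra_measurable.
Qed.

Lemma adapted_measurable n Z : adapted n Z -> measurable_fun [set: T] Z.
Proof.
by move=> mZ _ B mB; apply: (@g_sigma_measurable n); exact: mZ.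
Qed.

Lemma adaptedS n Z : adapted n Z -> adapted n.+1 Z.
Proof.
move=> mZ _ B mB.
have : <<s G n >> `<=` <<s G n.+1 >>.
  by apply: smallest_sub; [exact: smallest_sigma_algebra|exact: G_mono].
by apply; exact: mZ.
Qed.

(** Martingale differences are described without conditional expectations: [m n]
    is orthogonal to every square-integrable function of the past. *)
Variables (m : nat -> T -> R) (v : nat -> R).
Hypothesis m_adapted : forall n, adapted n.+1 (m n).
Hypothesis m_v : forall n, (\int[P]_w (m n w ^+ 2)%:E <= (v n)%:E)%E.
Hypothesis m_orth : forall n Z, adapted n Z ->
  (\int[P]_w (Z w ^+ 2)%:E < +oo)%E -> (\int[P]_w (Z w * m n w)%:E = 0)%E.

(** Increments from time [N] on, frozen as soon as the sum leaves the interval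
    from [- e] to [e]. The freezing factor depends on the past only, so the
    stopped sum is again a martingale; and it remembers whether the original
    sum has ever left the interval. This gives Kolmogorov's maximal inequality
    from Chebyshev's. *)
Fixpoint stopped_sum (e : R) N k (w : T) : R :=
  if k is j.+1 then
    let s := stopped_sum e N j w in
    s + (if `|s| < e then 1 else 0) * m (N + j) w
  else 0.

Lemma stopped_sum_adapted e N k : adapted (N + k) (stopped_sum e N k).
Proof.
elim: k => [|k IH] /=; first exact: measurable_cst.
rewrite addnS; apply: measurable_funD; first exact: adaptedS.
apply: measurable_funM; last exact: m_adapted.
apply: measurable_fun_ifT; [|exact: measurable_cst|exact: measurable_cst].
apply: measurable_fun_ltr; last exact: measurable_cst.
by apply: measurableT_comp => //; exact: adaptedS.
Qed.

Lemma stopped_sum_sqr e N k :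
  (\int[P]_w (stopped_sum e N k w ^+ 2)%:E <= (\sum_(N <= i < N + k) v i)%:E)%E.
Proof.
elim: k => [|k IH].
  rewrite addn0 big_geq//=; under eq_integral do rewrite expr0n/=.
  by rewrite integral0.
set Z := stopped_sum e N k in IH *.
pose c w : R := if `|Z w| < e then 1 else 0.
have kZ : adapted (N + k) Z := @stopped_sum_adapted e N k.
have mZ : measurable_fun setT Z := adapted_measurable kZ.
have kc : adapted (N + k) c.
  apply: measurable_fun_ifT; [|exact: measurable_cst|exact: measurable_cst].
  apply: measurable_fun_ltr; last exact: measurable_cst.
  exact: measurableT_comp.
have mm : measurable_fun setT (m (N + k)) := adapted_measurable (@m_adapted (N + k)%N).
have mc : measurable_fun setT c := adapted_measurable kc.
have iZ : (\int[P]_w (Z w ^+ 2)%:E < +oo)%E by exact: le_lt_trans IH (ltry _).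
have im : (\int[P]_w (m (N + k) w ^+ 2)%:E < +oo)%E.
  exact: le_lt_trans (m_v _) (ltry _).
have cZ w : (Z w * c w) ^+ 2 <= Z w ^+ 2.
  by rewrite /c; case: ifP => _; rewrite ?mulr1// mulr0 expr0n sqr_ge0.
have cm w : (c w * m (N + k) w) ^+ 2 <= m (N + k) w ^+ 2.
  by rewrite /c; case: ifP => _; rewrite ?mul1r// mul0r expr0n sqr_ge0.
have iZc : (\int[P]_w ((Z w * c w) ^+ 2)%:E < +oo)%E.
  apply: le_lt_trans iZ; apply: ge0_le_integral => //.
  - by move=> w _; rewrite lee_fin sqr_ge0.
  - by apply/measurable_EFinP; apply: measurable_funX; exact: measurable_funM.
  - by apply/measurable_EFinP; exact: measurable_funX.
  - by move=> w _; rewrite lee_fin.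
have lecm : (\int[P]_w ((c w * m (N + k) w) ^+ 2)%:E <= (v (N + k)%N)%:E)%E.
  apply: le_trans (m_v _); apply: ge0_le_integral => //.
  - by move=> w _; rewrite lee_fin sqr_ge0.
  - by apply/measurable_EFinP; apply: measurable_funX; exact: measurable_funM.
  - by apply/measurable_EFinP; exact: measurable_funX.
  - by move=> w _; rewrite lee_fin.
have icm : (\int[P]_w ((c w * m (N + k) w) ^+ 2)%:E < +oo)%E.
  exact: le_lt_trans lecm (ltry _).
have cross : (\int[P]_w ((Z w * c w) * m (N + k) w)%:E = 0)%E.
  by apply: m_orth => //; exact: measurable_funM.
have icross : P.-integrable setT (fun w => ((Z w * c w) * m (N + k) w)%:E).
  by apply: integrable_prod => //; exact: measurable_funM.
have i1 := integrable_sqr mZ iZ.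
have i3 : P.-integrable setT (fun w => ((c w * m (N + k) w) ^+ 2)%:E).
  by apply: integrable_sqr => //; exact: measurable_funM.
have i2 : P.-integrable setT
    (fun w => 2%:E * ((Z w * c w) * m (N + k) w)%:E)%E by exact: integrableZl.
rewrite addnS big_nat_recr/= ?leq_addr//.
rewrite (_ : (fun w => _) = ((fun w => (Z w ^+ 2)%:E) \+
   (fun w => 2%:E * ((Z w * c w) * m (N + k) w)%:E) \+
   (fun w => ((c w * m (N + k) w) ^+ 2)%:E))%E); last first.
  apply/funext => w /=; rewrite -/Z -/(c w) -EFinM -!EFinD; congr EFin; ring.
rewrite integralD//; last exact: integrableD.
(* the cross term vanishes: [Z * c] depends on the past only *)
rewrite integralD// integralZl// cross mule0 adde0 EFinD.
exact: leeD.
Qed.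

(** If the sum has not left the interval at time [k], it has never been
    frozen. *)
Lemma stopped_sumE e N k w : `|stopped_sum e N k w| < e ->
  forall j, (j <= k)%N ->
    stopped_sum e N j w = series (fun i => m i w) (N + j)%N - series (fun i => m i w) N
    /\ `|stopped_sum e N j w| < e.
Proof.
elim: k => [|k IH] /=.
  by move=> e0 j; rewrite leqn0 => /eqP ->; rewrite addn0 subrr.
case: ifPn => [Zk|]; last first.
  by rewrite mul0r addr0 => /negP h1 h2; exfalso; exact: h1.
rewrite mul1r => ZSk j; rewrite leq_eqVlt => /orP[/eqP ->|]; last first.
  by rewrite ltnS; exact: IH.
rewrite /= Zk mul1r; split => //.
have [-> _] := IH Zk k (leqnn k).
rewrite addnS !seriesEnat /= big_nat_recr//=; lra.
Qed.

Lemma stopped_chebyshev (e c : R) N k : 0 < e ->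
  \sum_(N <= i < N + k) v i <= c ->
  (P [set w | (e <= `|stopped_sum e N k w|)%R] <= (c / e ^+ 2)%:E)%E.
Proof.
move=> e0 vc.
have mZ := adapted_measurable (@stopped_sum_adapted e N k).
set Z := stopped_sum e N k in mZ *.
set A := [set w | _].
have mA : measurable A.
  by apply: (@measurable_ge_set _ _ _ (fun w => `|Z w|)); exact: measurableT_comp.
have e20 : 0 < e ^+ 2 by rewrite exprn_gt0.
have : ((e ^+ 2)%:E * P A <= c%:E)%E.
  apply: (@le_trans _ _ (\int[P]_w (Z w ^+ 2)%:E)%E); last first.
    by apply: le_trans (stopped_sum_sqr e N k) _; rewrite lee_fin.
  have -> : ((e ^+ 2)%:E * P A = \int[P]_w ((e ^+ 2)%:E * (\1_A w)%:E))%E.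
    rewrite integralZl//; last by apply: integrable_indic => //; rewrite ltry_probability.
    by rewrite integral_indic// setIT.
  apply: ge0_le_integral => //.
  - by move=> w _; rewrite -EFinM lee_fin mulr_ge0// sqr_ge0.
  - by apply/measurable_EFinP; apply: measurable_funM.
  - by apply/measurable_EFinP; exact: measurable_funX.
  - move=> w _; rewrite -EFinM lee_fin indicE; case: (boolP (w \in A)) => wA.
      rewrite mulr1 -[Z w ^+ 2]real_normK ?num_real//.
      rewrite ler_pXn2r// ?nnegrE ?normr_ge0 ?(ltW e0)//.
      exact: set_mem wA.
    by rewrite mulr0 sqr_ge0.
rewrite -(@fineK _ (P A)) ?fin_num_measure// -EFinM !lee_fin => h.
by rewrite ler_pdivlMr// mulrC.
Qed.

Hypothesis v_tail : forall dl : R, 0 < dl ->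
  exists N, forall k, \sum_(N <= i < N + k) v i <= dl.

(** [E j N] is the event that the partial sums after time [N] ever move by
    [j.+1%:R^-1]. Outside of the union over [j] of the intersections over [N] of
    these events the partial sums are Cauchy, and the maximal inequality bounds
    the probability of [E j N] by a multiple of the tail of [series v]. *)
Lemma martingale_ae_cvg : {ae P, forall w, cvgn (series (fun i => m i w))}.
Proof.
pose E j N := \bigcup_k [set w | j.+1%:R^-1 <= `|stopped_sum j.+1%:R^-1 N k w|].
have mE j N : measurable (E j N).
  apply: bigcupT_measurable => k.
  apply: (@measurable_ge_set _ _ _ (fun w => `|stopped_sum _ N k w|)).
  by apply: measurableT_comp => //; exact: adapted_measurable (@stopped_sum_adapted _ N k).
have PE j N c : (forall k, \sum_(N <= i < N + k) v i <= c) ->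
    (P (E j N) <= (c / j.+1%:R^-1 ^+ 2)%:E)%E.
  move=> vc.
  have : P \o (fun k => [set w | j.+1%:R^-1 <= `|stopped_sum j.+1%:R^-1 N k w|])
      @ \oo --> P (E j N).
    apply: nondecreasing_cvg_mu => //.
    - move=> k.
      apply: (@measurable_ge_set _ _ _ (fun w => `|stopped_sum _ N k w|)).
      by apply: measurableT_comp => //; exact: adapted_measurable (@stopped_sum_adapted _ N k).
    - exact: mE.
    - move=> a b ab; rewrite -(subnK ab); elim: (b - a)%N => [//|k IH].
      rewrite addSn; apply: le_trans IH _; apply/subsetPset => w /= jk.
      by rewrite ltNge jk /= mul0r addr0.
  move=> Pcvg; rewrite -(cvg_lim _ Pcvg)//; apply: lime_le; first exact: cvgP Pcvg.
  by apply: nearW => k; apply: stopped_chebyshev => //; rewrite invr_gt0.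
have : P.-negligible (\bigcup_j \bigcap_N E j N).
  apply: negligible_bigcup => j.
  exists (\bigcap_N E j N); split => //; first exact: bigcapT_measurable.
  apply/eqP; rewrite eq_le measure_ge0 andbT.
  apply/lee_addgt0Pr => e e0; rewrite add0e.
  have i0 : (0 : R) < j.+1%:R^-1 ^+ 2 by rewrite exprn_gt0.
  have [N NP] := v_tail (mulr_gt0 e0 i0).
  apply: (@le_trans _ _ (P (E j N))).
    apply: le_measure; [|exact/mem_set/mE|by move=> w; exact].
    by apply: mem_set; exact: bigcapT_measurable.
  by apply: le_trans (PE j N _ NP) _; rewrite mulfK ?gt_eqF.
apply: negligibleS => w /= ncv; apply: contrapT => nE; apply: ncv.
apply: cauchy_cvg; apply: cauchy_exP => e e0.
pose S n w := series (fun i => m i w) n.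
have [j _ jP] := near_infty_natSinv_lt (PosNum e0).
have : exists N, ~ E j N w.
  by apply/existsNP => EN; apply: nE; exists j => // N _; exact: EN.
move=> [N NP]; exists (S N w).
exists N => // n /= Nn.
have Zn : `|stopped_sum j.+1%:R^-1 N (n - N) w| < j.+1%:R^-1.
  by rewrite ltNge; apply/negP => h; apply: NP; exists (n - N)%N.
have [h1 h2] := stopped_sumE Zn (leqnn _).
rewrite /ball/= distrC -/(S n w) -/(S N w).
rewrite subnKC// -/(S n w) -/(S N w) in h1; rewrite h1 in h2.
by apply: lt_trans h2 _; exact: (jP j (leqnn j)).
Qed.

End Martingale.

(** * Independence from the past *)

Section Freezing.
Context {d d1 d2 : measure_display} {T : measurableType d}
  {T1 : measurableType d1} {T2 : measurableType d2} {R : realType}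
  (P : probability T R) (mu : probability T2 R).
Variables (X : T -> T1) (Y : T -> T2).
Hypothesis mX : measurable_fun setT X.
Hypothesis mY : measurable_fun setT Y.
Hypothesis XY_indep : forall A B, measurable A -> measurable B ->
  (P (X @^-1` A `&` Y @^-1` B) = P (X @^-1` A) * mu B)%E.

(** The law of the pair [(X, Y)] is a product, so by Fubini one may integrate
    over [Y] first, with [X] frozen. *)
Lemma freezing (h : T1 * T2 -> R) : measurable_fun setT h ->
  P.-integrable setT (fun w => (h (X w, Y w))%:E) ->
  (forall x, \int[mu]_y (h (x, y))%:E = 0)%E ->
  (\int[P]_w (h (X w, Y w))%:E = 0)%E.
Proof.
move=> mh ih h0.
pose Z w := (X w, Y w).
have mZ : measurable_fun setT Z by exact: measurable_fun_pair.
pose Z' : {mfun T >-> (T1 * T2)%type} := mfun_Sub (mem_set mZ).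
pose X' : {mfun T >-> T1} := mfun_Sub (mem_set mX).
have lawZ : forall A, measurable A ->
    (distribution P X' \x mu)%E A = distribution P Z' A.
  apply: product_measure_unique => A B mA mB.
  by rewrite -XY_indep.
have mh' : measurable_fun setT (EFin \o h) by exact/measurable_EFinP.
rewrite (_ : (\int[P]_w _)%E = \int[distribution P Z']_z ((EFin \o h) z))%E; last first.
  by rewrite integral_distribution.
rewrite (eq_measure_integral (distribution P X' \x mu)%E); last first.
  by move=> A mA _; apply/esym; exact: lawZ.
have ihp : (distribution P X' \x mu)%E.-integrable setT (EFin \o h).
  apply/integrableP; split => //.
  rewrite (eq_measure_integral (distribution P Z')); last first.
    by move=> A mA _; exact: lawZ.
  have /integrableP[_] := @integrable_pushforward _ _ _ _ _ _ mZ P setT _ mh' ih measurableT.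
  exact.
rewrite -integral12_prod_meas1//.
by under eq_integral do rewrite /fubini_F h0; rewrite integral0.
Qed.

End Freezing.

Section Past.
Context {d d' : measure_display} {Omega : measurableType d}
  {S : measurableType d'} {R : realType} (P : probability Omega R)
  (mu : probability S R) (xi : nat -> {RV P >-> S}).
Hypothesis xi_indep : independent_RVs xi.
Hypothesis xi_law : forall i (A : set S), measurable A ->
  distribution P (xi i) A = mu A.

(** Cylinders over the first [n] variables. They are stable under intersection,
    contain the whole space, and generate the sigma-algebra of the past. *)
Definition past n : set (set Omega) :=
  [set A | exists2 B : nat -> set S, (forall i, measurable (B i)) &
     A = \bigcap_(i in `I_n) (xi i @^-1` B i)].

Lemma measurable_preimage_xi i (B : set S) : measurable B ->
  measurable (xi i @^-1` B).
Proof. by move=> mB; rewrite -[_ @^-1` _]setTI; exact: measurable_funP. Qed.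

Lemma past_measurable n : past n `<=` measurable.
Proof.
move=> _ [B mB ->]; apply: bigcap_measurableType => i _.
exact: measurable_preimage_xi.
Qed.

Lemma pastS n : past n `<=` past n.+1.
Proof.
move=> _ [B mB ->].
exists (fun i => if (i < n)%N then B i else setT).
  by move=> i; case: ifP.
apply/seteqP; split => w /= wB i /= ni.
  by case: ifP => // h; apply: wB.
by have := wB i (ltnW ni); rewrite /= ni.
Qed.

Lemma past_sub n : past n `<=` <<s past n.+1 >>.
Proof. by move=> A /pastS; exact: sub_sigma_algebra. Qed.

Lemma past_xi n (B : set S) : measurable B -> past n.+1 (xi n @^-1` B).
Proof.
move=> mB; exists (fun i => if (i < n)%N then setT else B).
  by move=> i; case: ifP.
apply/seteqP; split => w /= wB.
  by move=> i; rewrite /= ltnS leq_eqVlt => /orP[/eqP ->|->//]; rewrite ltnn.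
by have := wB n (ltnSn n); rewrite /= ltnn.
Qed.

Lemma pastI n : setI_closed (past n).
Proof.
move=> _ _ [A mA ->] [B mB ->]; exists (fun i => A i `&` B i).
  by move=> i; exact: measurableI.
by rewrite -bigcapI; apply: eq_bigcapr => i _; rewrite preimage_setI.
Qed.

Lemma pastT n : past n setT.
Proof. by exists (fun=> setT) => //; rewrite bigcapT. Qed.

Lemma past_cylinder n (B : nat -> set S) : (forall i, measurable (B i)) ->
  (P (\bigcap_(i in `I_n) (xi i @^-1` B i)) = \prod_(i < n) mu (B i))%E.
Proof.
move=> mB; have := @xi_indep [fset i | i in iota 0 n]%fset B (fun i _ => mB i).
rewrite (_ : [set` _] = `I_n); last first.
  by apply/seteqP; split => i /=; rewrite in_fset/= mem_iota add0n.
move=> ->.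
rewrite (perm_big (iota 0 n)); last first.
  apply: uniq_perm; [exact: fset_uniq|exact: iota_uniq|].
  by move=> i; rewrite in_fset.
rewrite (_ : iota 0 n = index_iota 0 n) ?big_mkord//; last first.
  by rewrite /index_iota subn0.
by apply: eq_bigr => i _; apply: xi_law.
Qed.

(** Both sides are finite measures in [A] which agree on cylinders by mutual
    independence, hence agree on the generated sigma-algebra. *)
Lemma past_indep n A (B : set S) : <<s past n >> A -> measurable B ->
  (P (A `&` xi n @^-1` B) = P A * mu B)%E.
Proof.
move=> sA mB.
have mxB := measurable_preimage_xi n mB.
have m0 : 0 <= fine (mu B) by rewrite fine_ge0.
pose m1 := mrestr P mxB.
pose m2 := mscale (NngNum m0) P.
have -> : (P A * mu B = m2 A)%E.
  by rewrite /m2 /mscale/= muleC fineK// fin_num_measure.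
rewrite -[LHS]/(m1 A).
apply: (g_sigma_algebra_measure_unique (past n) _ (fun=> setT)) => //.
- exact: past_measurable.
- by move=> _; exact: pastT.
- by rewrite bigcup_const//; exists 0%N.
- exact: pastI.
- move=> _ [C mC ->].
  suff : (P (\bigcap_(i in `I_n) (xi i @^-1` C i) `&` xi n @^-1` B) =
      (fine (mu B))%:E * P (\bigcap_(i in `I_n) (xi i @^-1` C i)))%E by [].
  rewrite fineK ?fin_num_measure//.
  pose C' i := if (i < n)%N then C i else B.
  have mC' i : measurable (C' i) by rewrite /C'; case: ifP.
  rewrite (past_cylinder n mC).
  rewrite (_ : _ `&` _ = \bigcap_(i in `I_n.+1) (xi i @^-1` C' i)).
    rewrite past_cylinder// big_ord_recr/= /C' ltnn muleC; congr (_ * _)%E.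
    by apply: eq_bigr => i _; rewrite ltn_ord.
  rewrite /C'; apply/seteqP; split => w /=.
    move=> [wC wB] i; rewrite /= ltnS leq_eqVlt => /orP[/eqP ->|ni].
      by rewrite ltnn.
    by rewrite ni; exact: wC.
  move=> wC; split; last by have := wC n (ltnSn n); rewrite /= ltnn.
  by move=> i /= ni; have := wC i (ltnW ni); rewrite /= ni.
- move=> _; suff : (P (setT `&` xi n @^-1` B) < +oo)%E by [].
  by rewrite setTI; apply: le_lt_trans (ltry 1); exact: probability_le1.
Qed.

End Past.

(** * The stochastic proximal point algorithm for real-valued functions *)

Section Iteration.
Context {R : realType} {H : completeMetricType R} {dS dO : measure_display}
  {S : measurableType dS} {Omega : measurableType dO}
  (mu : probability S R) (P : probability Omega R).
Variables (f : H -> S -> R) (F : H -> R) (L : S -> R) (p : H).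
Variables (lambda : nat -> R) (xi : nat -> {RV P >-> S}) (x0 : H).
Hypothesis hadH : hadamard H.
Hypothesis lcH : locally_compact [set: H].
Hypothesis f_cvx : forall s (g : R -> H) (t : R), geodesic g -> 0 <= t <= 1 ->
  f (g t) s <= (1 - t) * f (g 0) s + t * f (g 1) s.
Hypothesis mf : forall y, measurable_fun setT (f y).
Hypothesis L0 : forall s, 0 <= L s.
Hypothesis mL : measurable_fun setT L.
Hypothesis iL2 : (\int[mu]_s (L s ^+ 2)%:E < +oo)%E.
Hypothesis f_growth : forall x y s,
  f x s - f y s <= L s * (1 + mdist x p) * mdist x y.
Hypothesis int_f : forall y, mu.-integrable setT (EFin \o f y).
Hypothesis F_def : forall y, (F y)%:E = (\int[mu]_s (f y s)%:E)%E.
Hypothesis lam0 : forall n, 0 < lambda n.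
Hypothesis lam2 : (\sum_(0 <= i <oo) (lambda i ^+ 2)%:E < +oo)%E.
Hypothesis xi_indep : independent_RVs xi.
Hypothesis xi_law : forall i (A : set S), measurable A ->
  distribution P (xi i) A = mu A.

Let X n w := proximal_point (fun y s => (f y s)%:E) lambda (fun j => xi j w) x0 n.

Let l1 := fine (\int[mu]_s (L s)%:E)%E.

Let int_L : mu.-integrable setT (EFin \o L).
Proof. exact: integrable_of_sqr. Qed.

Let int_LE : (\int[mu]_s (L s)%:E)%E = l1%:E.
Proof. by apply/esym/fineK/(integrable_fin_num _ int_L). Qed.

Let l1_ge0 : 0 <= l1.
Proof. by apply/fine_ge0/integral_ge0 => s _; rewrite lee_fin. Qed.

Let f_continuous s : continuous (f ^~ s).
Proof. by apply: (@growth_continuous _ _ _ (L s) p) => // x y; exact: f_growth. Qed.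

Let F_le x y (c : R) : (forall s, f x s - f y s <= L s * c) -> F x - F y <= l1 * c.
Proof.
move=> fc; rewrite -lee_fin EFinB !F_def -(integralB measurableT (int_f x) (int_f y)).
rewrite EFinM -int_LE -(integralZr measurableT int_L).
apply: le_integral => //.
- exact: (integrableB measurableT (int_f x) (int_f y)).
- exact: (integrableZr measurableT _ int_L).
by move=> s _; rewrite -EFinB -EFinM lee_fin; exact: fc.
Qed.

Let F_growth x y : F x - F y <= l1 * (1 + mdist x p) * mdist x y.
Proof. by rewrite -mulrA; apply: F_le => s; rewrite mulrA. Qed.

Lemma expected_growth_continuous : continuous F.
Proof. exact: (@growth_continuous _ _ _ l1 p). Qed.

Let Fn n := past xi n.

(** The next iterate minimizes a function that depends measurably on the current
    iterate and on [xi n], and continuously on the point. *)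
Let X_adapted n : dist_measurable (X n : g_sigma_algebraType (Fn n) -> H).
Proof.
have [q qd] := dense_sequence hadH lcH.
elim: n => [|n IH]; first by move=> y; exact: (measurable_cst (mdist y x0)).
pose phi y w := f y (xi n w) + (2 * lambda n)^-1 * mdist (X n w) y ^+ 2.
have c0 : 0 < (2 * lambda n)^-1 by rewrite invr_gt0 mulr_gt0.
have m_xi y : measurable_fun [set: g_sigma_algebraType (Fn n.+1)]
    (fun w => f y (xi n w)).
  apply: (measurableT_comp (mf y)) => _ B mB; rewrite setTI.
  by apply: sub_sigma_algebra; exact: past_xi.
apply: (@argmin_measurable _ _ _ qd _ (g_sigma_algebraType (Fn n.+1)) _ phi _ c0).
- move=> y; apply: measurable_funD => //; apply: measurable_funM => //.
  apply: measurable_funX.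
  have := @adaptedS _ _ _ Fn (past_sub (xi := xi)) n _ (IH y).
  by rewrite /adapted; under eq_fun do rewrite metric_sym.
- move=> w y; apply: cvgD; first exact: f_continuous.
  by apply: cvgMr; rewrite expr2; apply: cvgM; exact: mdist_continuous.
- move=> w y.
  apply: (@resolvent_strongly_minimizes _ _ hadH lcH _ (L (xi n w)) p) => // g t.
  exact: f_cvx.
Qed.

Section FixedMinimizer.
Variable z : H.
Hypothesis z_min : forall y, F z <= F y.

(** [D] absorbs the distance from [z] to the base point of the growth condition:
    [1 + mdist y p] is at most [D + mdist z y]. *)
Let D := 1 + mdist z p.
Let V y := mdist z y ^+ 2.

Let D1 : 1 <= D. Proof. by rewrite lerDl mdist_ge0. Qed.

Let V0 y : 0 <= V y. Proof. by rewrite sqr_ge0. Qed.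

Let V10 y : 0 < 1 + V y. Proof. by rewrite ltr_wpDr. Qed.

Let mdist_p y : 1 + mdist y p <= D + mdist z y.
Proof. by have := metric_triangle y z p; rewrite (metric_sym y z) /D; lra. Qed.

Let excess_bound y s : `|f y s - f z s| <= L s * (2 * D * (1 + V y)).
Proof.
have t0 := mdist_ge0 z y.
have h t u : 0 <= t -> 0 <= u -> t <= D + u -> t * u <= 2 * D * (1 + u ^+ 2).
  move=> t0' u0 tDu; apply: le_trans (ler_wpM2r u0 tDu) _.
  have : D * u <= D * (1 + u ^+ 2).
    by rewrite ler_wpM2l ?(le_trans ler01 D1)//; have := sqr_ge0 (u - 1); nra.
  have : 1 * u ^+ 2 <= D * u ^+ 2 by rewrite ler_wpM2r ?sqr_ge0.
  move: (le_trans ler01 D1); lra.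
rewrite ler_norml; apply/andP; split.
  rewrite -opprB lerN2; apply: le_trans (f_growth _ _ _) _.
  rewrite -mulrA ler_wpM2l// h ?addr_ge0 ?mdist_ge0// /D; lra.
apply: le_trans (f_growth _ _ _) _.
rewrite -mulrA ler_wpM2l// (metric_sym y z) h ?addr_ge0 ?mdist_ge0//.
Qed.

Let expected_excess_bound y : `|F y - F z| <= l1 * (2 * D * (1 + V y)).
Proof.
rewrite ler_norml; apply/andP; split.
  rewrite -opprB lerN2; apply: F_le => s.
  by have := excess_bound y s; rewrite ler_norml => /andP[? _]; lra.
apply: F_le => s.
by have := excess_bound y s; rewrite ler_norml => /andP[_ ?]; lra.
Qed.

(** Excess of [f y] over [f z], centred and divided by [1 + V y], which makes the
    bound [K] below independent of [y]. *)
Let k y s := (1 + V y)^-1 * (f y s - f z s - (F y - F z)).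

Let K s := 2 * D * (L s + l1).

Let k_bound y s : `|k y s| <= K s.
Proof.
rewrite /k normrM gtr0_norm ?invr_gt0// ler_pdivrMl//.
apply: le_trans (ler_normB _ _) _.
apply: le_trans (lerD (excess_bound y s) (expected_excess_bound y)) _.
by rewrite /K; lra.
Qed.

Let k_sqr y s : k y s ^+ 2 <= K s ^+ 2.
Proof.
rewrite -[leLHS]real_normK ?num_real// ler_pXn2r ?nnegrE//.
by apply: le_trans (k_bound y s).
Qed.

Let k_centred y : (\int[mu]_s (k y s)%:E = 0)%E.
Proof.
have iB := integrableB measurableT (int_f y) (int_f z).
have ic : mu.-integrable setT (fun=> (F y - F z)%:E).
  by apply/integrableP; split => //; rewrite integral_cst//= ltey_eq fin_numM// fin_num_measure.
rewrite (_ : (fun s => _) = (fun s => (1 + V y)^-1%:E *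
   (((f y s)%:E - (f z s)%:E) - (F y - F z)%:E))%E); last first.
  by [].
rewrite integralZl//; last exact: integrableB.
rewrite integralB// (integralB measurableT (int_f y) (int_f z)) -!F_def.
have -> : (\int[mu]__ (F y - F z)%:E = (F y - F z)%:E)%E.
  by rewrite integral_cst// -[RHS]mule1; congr (_ * _)%E; exact: probability_setT.
by rewrite EFinB subee// mule0.
Qed.

Let k_measurable y : measurable_fun setT (k y).
Proof.
apply: measurable_funM => //; apply: measurable_funB => //.
exact: measurable_funB.
Qed.

Let k_continuous s : continuous (k ^~ s).
Proof.
move=> y; apply: cvgM.
  apply: cvgV; first by rewrite gt_eqF.
  apply: cvgD; first exact: cvg_cst.
  by rewrite /V expr2; apply: cvgM; exact: mdist_continuous.
apply: cvgB; apply: cvgB; try exact: cvg_cst.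
  exact: f_continuous.
exact: expected_growth_continuous.
Qed.

Let K_measurable : measurable_fun setT K.
Proof. by apply: measurable_funM => //; exact: measurable_funD. Qed.

Let K_sqr_lty : (\int[mu]_s (K s ^+ 2)%:E < +oo)%E.
Proof.
have i1 := integrable_sqr mL iL2.
have i2 : mu.-integrable setT (fun=> (l1 ^+ 2)%:E).
  by apply/integrableP; split => //; rewrite integral_cst//= ltey_eq fin_numM// fin_num_measure.
(* the factor 8 is [2 ^+ 2 * 2], from [(a + b) ^+ 2 <= 2 * (a ^+ 2 + b ^+ 2)] *)
have i3 := integrableZl measurableT (8 * D ^+ 2) (integrableD measurableT i1 i2).
apply: le_lt_trans (integrable_lty measurableT i3).
apply: ge0_le_integral => //.
- by move=> s _; rewrite lee_fin sqr_ge0.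
- by apply/measurable_EFinP; exact: measurable_funX.
- exact: measurable_int i3.
move=> s _; rewrite -EFinD -EFinM lee_fin /K exprMn.
rewrite (_ : (2 * D) ^+ 2 = 4 * D ^+ 2); last by ring.
rewrite (_ : 8 * D ^+ 2 = 4 * D ^+ 2 * 2); last by ring.
rewrite -mulrA ler_wpM2l//; first by rewrite mulr_ge0// sqr_ge0.
have := sqr_ge0 (L s - l1); nra.
Qed.

(** The martingale differences: with [X n] known, only [xi n] is random, and [k]
    has mean zero in its second argument. *)
Let m n w := - (2 * lambda n) * k (X n w) (xi n w).
Let c := fine (\int[mu]_s (K s ^+ 2)%:E)%E.
Let v n := (4 * c) * lambda n ^+ 2.

Let c0 : 0 <= c.
Proof. by apply/fine_ge0/integral_ge0 => s _; rewrite lee_fin sqr_ge0. Qed.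

Let m_adapted n : adapted Fn n.+1 (m n).
Proof.
have [q qd] := dense_sequence hadH lcH.
apply: measurable_funM; first exact: measurable_cst.
apply: (@measurable_fun_caratheodory _ _ _ qd _ (g_sigma_algebraType (Fn n.+1)) (X n)
   (fun y w => k y (xi n w))).
- move=> y; exact: (@adaptedS _ _ _ Fn (past_sub (xi := xi)) n _ (@X_adapted n y)).
- move=> y; apply: (measurableT_comp (k_measurable y)) => _ B mB; rewrite setTI.
  by apply: sub_sigma_algebra; exact: past_xi.
- by move=> w; exact: k_continuous.
Qed.

Let m_measurable n : measurable_fun setT (m n).
Proof. exact: (adapted_measurable (past_measurable (xi := xi)) (@m_adapted n)). Qed.

Let integral_xi n (h : S -> \bar R) : measurable_fun setT h ->
  (forall s, 0 <= h s)%E -> (\int[P]_w h (xi n w) = \int[mu]_s h s)%E.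
Proof.
move=> mh h0; rewrite -(ge0_integral_distribution (xi n) mh h0).
by apply: eq_measure_integral => A mA _; exact: xi_law.
Qed.

Let m_v n : (\int[P]_w (m n w ^+ 2)%:E <= (v n)%:E)%E.
Proof.
have mKxi : measurable_fun setT (fun w => K (xi n w)) by exact: measurableT_comp.
apply: (@le_trans _ _ (\int[P]_w ((4 * lambda n ^+ 2)%:E * (K (xi n w) ^+ 2)%:E))%E).
  apply: ge0_le_integral => //.
  - by move=> w _; rewrite lee_fin sqr_ge0.
  - by apply/measurable_EFinP; exact: measurable_funX.
  - apply/measurable_EFinP; apply: measurable_funM => //.
    exact: measurable_funX.
  move=> w _; rewrite -EFinM lee_fin /m exprMn.
  rewrite (_ : (- (2 * lambda n)) ^+ 2 = 4 * lambda n ^+ 2); last by ring.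
  by rewrite ler_wpM2l// mulr_ge0// sqr_ge0.
rewrite ge0_integralZl//; first last.
- by rewrite lee_fin mulr_ge0// sqr_ge0.
- by move=> w _; rewrite lee_fin sqr_ge0.
- by apply/measurable_EFinP; exact: measurable_funX.
rewrite (integral_xi n (h := fun s => (K s ^+ 2)%:E)).
- rewrite -[(\int[mu]_s _)%E]fineK; last first.
    by rewrite ge0_fin_numE//; apply: integral_ge0 => s _; rewrite lee_fin sqr_ge0.
  by rewrite -/c -EFinM lee_fin /v; lra.
- by apply/measurable_EFinP; exact: measurable_funX.
- by move=> s; rewrite lee_fin sqr_ge0.
Qed.

Let m_orth n Z : adapted Fn n Z ->
  (\int[P]_w (Z w ^+ 2)%:E < +oo)%E -> (\int[P]_w (Z w * m n w)%:E = 0)%E.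
Proof.
move=> kZ iZ.
have [q qd] := dense_sequence hadH lcH.
have mZ := adapted_measurable (past_measurable (xi := xi)) kZ.
have im2 : (\int[P]_w (m n w ^+ 2)%:E < +oo)%E := le_lt_trans (m_v n) (ltry _).
have iZm := integrable_prod mZ (@m_measurable n) iZ im2.
pose h (ws : g_sigma_algebraType (Fn n) * S) :=
  Z ws.1 * (- (2 * lambda n) * k (X n ws.1) ws.2).
apply: (@freezing _ _ _ Omega (g_sigma_algebraType (Fn n)) S R P mu id (xi n) _ _ _ h) => //.
- move=> _ B mB; rewrite setTI preimage_id.
  by apply: g_sigma_measurable mB; exact: past_measurable.
- by move=> A B mA mB; rewrite preimage_id; exact: past_indep.
- apply: measurable_funM; first exact: (measurableT_comp kZ).
  apply: measurable_funM => //.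
  apply: (@measurable_fun_caratheodory _ _ _ qd _
     (g_sigma_algebraType (Fn n) * S)%type (fun ws => X n ws.1)
     (fun y ws => k y ws.2)).
  + by move=> y; exact: (measurableT_comp (@X_adapted n y) measurable_fst).
  + by move=> y; exact: (measurableT_comp (k_measurable y) measurable_snd).
  + by move=> ws; exact: k_continuous.
- move=> w; rewrite /h /=.
  under eq_integral do rewrite mulrA EFinM.
  rewrite integralZl//; first by rewrite k_centred mule0.
  have ik := integrable_of_sqr K_measurable K_sqr_lty.
  apply: le_integrable ik => //; first exact/measurable_EFinP.
  move=> s _ /=; rewrite lee_fin; apply: le_trans (k_bound _ s) _.
  exact: ler_norm.
Qed.

Let b n w := 2 * D ^+ 2 * lambda n ^+ 2 * L (xi n w) ^+ 2.

(** The three-point inequality involves [f] at the new iterate. The growth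
    condition moves it back to the old one, at the cost of a product that the
    square of the step length absorbs, leaving an error of order
    [lambda n ^+ 2]. *)
Let one_step n w : V (X n.+1 w) <= V (X n w)
  - 2 * lambda n * (f (X n w) (xi n w) - f z (xi n w)) + b n w * (1 + V (X n w)).
Proof.
set x := X n w; set s := xi n w; set l := lambda n.
have : mdist (X n.+1 w) z ^+ 2 <= mdist x z ^+ 2 - mdist x (X n.+1 w) ^+ 2
    - 2 * l * (f (X n.+1 w) s - f z s).
  apply: (@resolvent_three_point _ _ hadH lcH (f ^~ s) (L s) p) => //.
  by move=> g t; exact: f_cvx.
rewrite (metric_sym _ z) -/(V (X n.+1 w)) (metric_sym x z) -/(V x).
set y := X n.+1 w => h1.
have h2 := f_growth x y s.
set e := mdist x y in h1 h2; set A := L s * (1 + mdist x p) in h2.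
have l0 : 0 < l := lam0 n.
have h3 : 2 * l * (f x s - f y s) <= 2 * l * (A * e).
  by rewrite ler_wpM2l// mulr_ge0// ltW.
have h4 : 2 * l * (A * e) <= e ^+ 2 + l ^+ 2 * A ^+ 2.
  by have := sqr_ge0 (e - l * A); nra.
have h5 : A ^+ 2 <= L s ^+ 2 * (2 * D ^+ 2 * (1 + V x)).
  rewrite /A exprMn ler_wpM2l ?sqr_ge0//.
  have h6 := mdist_p x; have xp := mdist_ge0 x p; have t0 := mdist_ge0 z x.
  apply: (@le_trans _ _ ((D + mdist z x) ^+ 2)).
    by rewrite ler_pXn2r// nnegrE; lra.
  have := sqr_ge0 (D - mdist z x).
  have D21 : 1 <= D ^+ 2 by rewrite expr_ge1// (le_trans ler01 D1).
  have := ler_wpM2r (V0 x) D21.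
  rewrite -/(V x) /V; set t := mdist z x; nra.
have h7 : l ^+ 2 * A ^+ 2 <= l ^+ 2 * (L s ^+ 2 * (2 * D ^+ 2 * (1 + V x))).
  by rewrite ler_wpM2l// sqr_ge0.
rewrite /b -/l -/s; lra.
Qed.

(** After division by [1 + V (X n w)] the error [b] depends on [xi n w] only, and
    the noise [m] is bounded by a function of [xi n w]. *)
Let log_step n w : ln (1 + V (X n.+1 w)) <= ln (1 + V (X n w))
  - 2 * lambda n * (F (X n w) - F z) / (1 + V (X n w)) + m n w + b n w.
Proof.
apply: le_trans (ln1D_step (V0 (X n w)) (V0 (X n.+1 w))) _.
have q0 := V10 (X n w).
have : (V (X n.+1 w) - V (X n w)) / (1 + V (X n w)) <=
    - (2 * lambda n * (f (X n w) (xi n w) - f z (xi n w))) / (1 + V (X n w))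
      + b n w.
  rewrite ler_pdivrMr// mulrDl divfK ?gt_eqF//.
  by have := one_step n w; lra.
rewrite /m /k => h.
rewrite -!addrA lerD2l; apply: le_trans h _; rewrite !addrA lerD2r.
by rewrite le_eqVlt; apply/orP; left; apply/eqP; field; rewrite gt_eqF.
Qed.

(** The drift converges as a series together with [ln (1 + V)]; since [V] is then
    bounded along the trajectory, the factors [1 + V] may be removed again. *)
Lemma ae_quasi_descent : {ae P, forall w,
  cvgn (fun n => mdist z (X n w)) /\
  exists M, forall n, series (fun i => lambda i * (F (X i w) - F z)) n <= M}.
Proof.
have lam2c : cvgn (series (fun n => lambda n ^+ 2)).
  by apply: nneseries_lty_cvgn lam2 => n; exact: sqr_ge0.
have vtail : forall e, 0 < e -> exists N, forall j, \sum_(N <= i < N + j) v i <= e.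
  apply: series_tail; first by move=> n; apply: mulr_ge0; [exact: mulr_ge0|exact: sqr_ge0].
  rewrite (_ : series v = (4 * c) *: series (fun n => lambda n ^+ 2)).
    exact: is_cvgZr.
  by rewrite -seriesZ.
have mcvg := martingale_ae_cvg (past_measurable (xi := xi)) (past_sub (xi := xi))
  m_adapted m_v m_orth vtail.
have bcvg : {ae P, forall w, cvgn (series (fun n => b n w))}.
  pose l2 := fine (\int[mu]_s (L s ^+ 2)%:E)%E.
  have l2E : (\int[mu]_s (L s ^+ 2)%:E)%E = l2%:E.
    apply/esym/fineK; rewrite ge0_fin_numE//.
    by apply: integral_ge0 => s _; rewrite lee_fin sqr_ge0.
  have d0 n : 0 <= 2 * D ^+ 2 * lambda n ^+ 2.
    by rewrite mulr_ge0 ?sqr_ge0// mulr_ge0 ?sqr_ge0.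
  have mLxi n : measurable_fun setT (fun w => L (xi n w) ^+ 2).
    by apply: measurable_funX; exact: measurableT_comp.
  apply: (@ae_series_cvg _ _ _ P b (fun n => (2 * D ^+ 2 * l2) * lambda n ^+ 2)).
  - by move=> n w; rewrite /b mulr_ge0// sqr_ge0.
  - by move=> n; apply: measurable_funM.
  - move=> n; rewrite /b; under eq_integral do rewrite EFinM.
    rewrite ge0_integralZl//; first last.
    + by rewrite lee_fin.
    + by move=> w _; rewrite lee_fin sqr_ge0.
    + exact/measurable_EFinP.
    rewrite (integral_xi n (h := fun s => (L s ^+ 2)%:E)).
    + by rewrite l2E -EFinM lee_fin; lra.
    + by apply/measurable_EFinP; exact: measurable_funX.
    + by move=> s; rewrite lee_fin sqr_ge0.
  - have l20 : 0 <= l2.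
      by apply/fine_ge0/integral_ge0 => s _; rewrite lee_fin sqr_ge0.
    under eq_eseriesr do rewrite EFinM.
    rewrite nneseriesZl; last by move=> n _; rewrite lee_fin sqr_ge0.
    apply: lte_mul_pinfty => //; first by rewrite lee_fin mulr_ge0// mulr_ge0 ?sqr_ge0.
near=> w.
have mw : cvgn (series (fun n => m n w)) by near: w; exact: mcvg.
have bw : cvgn (series (fun n => b n w)) by near: w; exact: bcvg.
have [|||lc [M aM]] := perturbed_decrease_cvg (Y := fun n => ln (1 + V (X n w)))
  (a := fun n => 2 * lambda n * (F (X n w) - F z) / (1 + V (X n w)))
  _ _ _ mw bw.
- by move=> n; apply: ln_ge0; rewrite lerDl.
- move=> n; rewrite divr_ge0 ?(ltW (V10 _))// mulr_ge0 ?subr_ge0//.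
  by rewrite mulr_ge0// ltW.
- by move=> n; exact: log_step.
have Vc := ln1D_cvg (fun n => V0 (X n w)) lc.
have [B VB] := cvgn_le_bound Vc.
split.
  rewrite (_ : (fun n => _) = Num.sqrt \o (fun n => V (X n w))); last first.
    by apply/funext => n /=; rewrite sqrtr_sqr ger0_norm// mdist_ge0.
  apply: cvgP; apply: (@cvg_comp _ _ _ (fun n => V (X n w)) Num.sqrt _ _ _ Vc); exact: sqrt_continuous.
exists ((1 + B) / 2 * M) => n.
apply: (@le_trans _ _ ((1 + B) / 2 * series
   (fun n => 2 * lambda n * (F (X n w) - F z) / (1 + V (X n w))) n)).
  rewrite !seriesEnat/= mulr_sumr; apply: ler_sum => i _.
  have G0 : 0 <= lambda i * (F (X i w) - F z) by rewrite mulr_ge0 ?subr_ge0// ltW.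
  have VBi : V (X i w) <= B by apply: le_trans (VB i); exact: ler_norm.
  have q0 := V10 (X i w).
  rewrite (_ : _ * (_ / _) = (lambda i * (F (X i w) - F z)) * ((1 + B) / (1 + V (X i w)))).
    by rewrite ler_peMr// ler_pdivlMr// mul1r lerD2l.
  by field; rewrite gt_eqF.
have B0 : 0 <= B by apply: le_trans (VB 0%N).
by rewrite ler_wpM2l// divr_ge0// addr_ge0.
Unshelve. all: by end_near. Qed.

End FixedMinimizer.

Hypothesis lam1 : (\sum_(0 <= i <oo) (lambda i)%:E = +oo)%E.

(** The exceptional null set of [ae_quasi_descent] depends on the minimizer, so
    the lemma is applied to a sequence that is dense in the set of minimizers.
    The limit is redefined as [z0] on a measurable null set, where convergence
    may fail, to be a measurable selection of minimizers everywhere. *)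
Lemma proximal_point_ae_cvg (z0 : H) : (forall y, F z0 <= F y) ->
  exists x : Omega -> borel H,
    [/\ measurable_fun setT x, forall w y, F (x w) <= F y &
        {ae P, forall w, X n w @[n --> \oo] --> (x w : H)}].
Proof.
move=> z0_min.
have [q qd] := dense_sequence hadH lcH.
pose M := [set z | forall y, F z <= F y].
have Mz0 : M z0 by [].
have : forall i : nat, exists z, M z /\
    forall jk : nat * nat, choice.unpickle i = Some jk ->
      (exists2 z', M z' & mdist (q jk.1) z' < jk.2.+1%:R^-1) ->
      mdist (q jk.1) z < jk.2.+1%:R^-1.
  move=> i; case: (choice.unpickle i) => [jk|]; last by exists z0.
  have [[z' Mz' qz']|nz'] := pselect (exists2 z', M z' & mdist (q jk.1) z' < jk.2.+1%:R^-1).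
    by exists z'; split => // _ [<-].
  by exists z0; split => // _ [<-].
(* [z] lists points of [M] close to each [q j], at all scales where they exist *)
move=> /choice[z zP].
have zd y e : M y -> 0 < e -> exists i, mdist (z i) y < e.
  move=> My e0; have e20 : 0 < e / 2 by rewrite divr_gt0.
  have [k _ kP] := near_infty_natSinv_lt (PosNum e20).
  have k0 : (0 : R) < k.+1%:R^-1 by rewrite invr_gt0.
  have [j qj] := qd y _ k0.
  exists (choice.pickle (j, k)).
  have := (zP (choice.pickle (j, k))).2 (j, k) (choice.pickleK _) (ex_intro2 _ _ y My qj).
  have := kP k (leqnn k); move: qj k0; rewrite /=; move: (k.+1%:R^-1) => i ? ? ?.
  set zi := z _ => ?.
  by have := metric_triangle zi (q j) y; rewrite (metric_sym zi (q j)); lra.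
pose good w u := cvgn (fun n => mdist u (X n w)) /\
  exists M, forall n, series (fun i => lambda i * (F (X i w) - F u)) n <= M.
have [N [mN N0 goodN]] : {ae P, forall w i, good w (z i)}.
  by apply: ae_foralln => i; apply: ae_quasi_descent; exact: (zP i).1.
have lamy := nneseries_y_unbounded (fun n => ltW (lam0 n)) lam1.
have lim_ex w : ~ N w -> exists xh, M xh /\ X n w @[n --> \oo] --> xh.
  move=> Nw; have gw i : good w (z i).
    by move: i; apply: contrapT => bad; apply: Nw; exact: goodN.
  have [c0 [B GB]] := gw 0%N.
  have Mz := (zP 0%N).1.
  have [C CP] := cvgn_le_bound c0.
  have [|||xh [xh0 xhcl]] := @small_value_cluster _ _ (cball (z 0%N) C) (X ^~ w)
      (fun y => F y - F (z 0%N)) lambda B (compact_cball hadH lcH) _ _ _ lam0 lamy GB.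
  - by move=> n; rewrite /cball/=; apply: le_trans (CP n); exact: ler_norm.
  - move=> y; apply: cvgB; last exact: cvg_cst.
    exact: expected_growth_continuous.
  - by move=> y; rewrite subr_ge0.
  have Mxh : M xh.
    by move=> y; move/eqP: xh0; rewrite subr_eq0 => /eqP ->; exact: Mz.
  exists xh; split => //.
  by apply: (@cluster_cvg _ _ M z) => // i; exact: (gw i).1.
have : forall w, exists xh, M xh /\ (~ N w -> X n w @[n --> \oo] --> xh).
  move=> w; have [Nw|/lim_ex[xh [? ?]]] := pselect (N w); last by exists xh.
  by exists z0; split => // ?.
move=> /choice[lim_w lim_wP].
pose x w := if w \in N then z0 else lim_w w.
have xP w : M (x w) by rewrite /x; case: ifP => _ //; exact: (lim_wP w).1.
exists x; split => //.
- apply: (dist_measurable_borel qd).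
  pose Y n w := if w \in N then z0 else X n w.
  apply: (@dist_measurable_cvg _ _ _ _ Y).
    move=> n y.
    rewrite (_ : (fun w => _) = (fun w => \1_N w * mdist y z0
        + \1_(~` N) w * mdist y (X n w))); last first.
      apply/funext => w; rewrite /Y !indicE in_setC.
      by case: (w \in N); rewrite /= !(mul1r, mul0r) ?addr0 ?add0r.
    apply: measurable_funD; apply: measurable_funM.
    - exact: measurable_indic.
    - exact: measurable_cst.
    - by apply: measurable_indic; exact: measurableC.
    - exact: (adapted_measurable (past_measurable (xi := xi)) (@X_adapted n y)).
  move=> w; rewrite /Y /x; case: ifPn => [_|]; first exact: cvg_cst.
  by rewrite notin_setE; exact: (lim_wP w).2.
- exists N; split => // w /= nx; apply: contrapT => Nw; apply: nx.
  by rewrite /x memNset//; exact: (lim_wP w).2.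
Qed.

End Iteration.

(** * Convergence *)

Local Open Scope ereal_scope.

Theorem theorem3p1 (R : realType) (H : completeMetricType R)
  (dS dO : measure_display) (S : measurableType dS) (Omega : measurableType dO)
  (mu : probability S R) (P : probability Omega R)
  (f : H -> S -> \bar R) (F : H -> \bar R)
  (lambda : nat -> R) (xi : nat -> {RV P >-> S}) (x0 : H)
  (H_hadamard : hadamard H)
  (H_locally_compact : locally_compact [set: H])
  (f_gtNy : forall x s, -oo < f x s)
  (f_convex : forall s, geodesically_convex (f ^~ s))
  (f_lsc : forall s, lower_semicontinuous (f ^~ s))
  (f_measurable : forall x, measurable_fun [set: S] (f x))
  (F_def : forall x, F x = \int[mu]_(s in [set: S]) f x s)
  (F_gtNy : forall x, -oo < F x)
  (F_lsc : lower_semicontinuous F)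
  (lambda_gt0 : forall i, (0 < lambda i)%R)
  (xi_independent : independent_RVs xi)
  (xi_distribution : forall i (A : set S), measurable A ->
     distribution P (xi i) A = mu A)
  (F_has_minimizer : minimizers F !=set0)
  (f_growth : exists (p : H) (L : S -> R),
     [/\ forall s, (0 < L s)%R,
         measurable_fun [set: S] L,
         \int[mu]_(s in [set: S]) (L s ^+ 2)%:E < +oo &
         forall (x y : H) (s : S), f x s +? - f y s /\
           f x s - f y s <= (L s * (1 + mdist x p) * mdist x y)%:E])
  (lambda_sum : \sum_(0 <= i <oo) (lambda i)%:E = +oo)
  (lambda_sum_sqr : \sum_(0 <= i <oo) (lambda i ^+ 2)%:E < +oo) :
  exists x : Omega -> borel H,
    [/\ measurable_fun [set: Omega] x,
        forall w, minimizers F (x w) &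
        {ae P, forall w,
           (fun i => proximal_point f lambda (fun j => xi j w) x0 i)
             @ \oo --> (x w : H)}].
Proof.
have [p [L [L0 mL iL2 growth]]] := f_growth.
(* at equal points, the growth condition excludes infinite values *)
have f_fin y s : f y s \is a fin_num.
  rewrite fin_numE gt_eqF//=; apply/eqP => fy.
  by have [] := growth y y s; rewrite fy.
pose fr y s := fine (f y s).
have fE : f = fun y s => (fr y s)%:E.
  by apply/funext => y; apply/funext => s; rewrite fineK.
have fr_growth x y s : (fr x s - fr y s <= L s * (1 + mdist x p) * mdist x y)%R.
  by rewrite -lee_fin EFinB; have [_] := growth x y s; rewrite fE.
have mfr y : measurable_fun setT (fr y).
  by apply/measurable_EFinP; have := f_measurable y; rewrite {1}fE.
have fr_cvx s (g : R -> H) (t : R) : geodesic g -> (0 <= t <= 1)%R ->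
    (fr (g t) s <= (1 - t) * fr (g 0%R) s + t * fr (g 1%R) s)%R.
  move=> gg t01; have o01 : (0 <= (1 : R) <= 1)%R by rewrite ler01 lexx.
  have z01 : (0 <= (0 : R) <= 1)%R by rewrite ler01 lexx.
  have := f_convex s g gg _ _ _ z01 o01 t01.
  by rewrite /= mulr0 mulr1 add0r fE -!EFinM -EFinD lee_fin.
have [z0 [Ffin z0inf]] := F_has_minimizer.
have int_z0 : mu.-integrable setT (EFin \o fr z0).
  have := @fin_num_integral_integrable _ _ _ mu (f z0) (f_measurable z0).
  by rewrite -F_def z0inf => /(_ Ffin); rewrite fE.
have int_L := integrable_of_sqr mL iL2.
(* [fr z0] is integrable, and the growth condition bounds [fr y - fr z0] *)
have int_fr y : mu.-integrable setT (EFin \o fr y).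
  pose C := ((1 + mdist y p) * mdist y z0 + (1 + mdist z0 p) * mdist z0 y)%R.
  have C0 : (0 <= C)%R by rewrite addr_ge0// mulr_ge0 ?addr_ge0 ?mdist_ge0.
  have := integrableD measurableT (integrable_abse int_z0)
    (integrableZr measurableT C int_L).
  apply: le_integrable => //; first exact/measurable_EFinP.
  move=> s _ /=; rewrite lee_fin.
  have h1 := fr_growth y z0 s; have h2 := fr_growth z0 y s.
  rewrite [leRHS]ger0_norm; last by rewrite addr_ge0// mulr_ge0// ltW.
  have p1 : (0 <= L s * (1 + mdist y p) * mdist y z0)%R.
    by rewrite !mulr_ge0 ?addr_ge0 ?mdist_ge0// ltW.
  have p2 : (0 <= L s * (1 + mdist z0 p) * mdist z0 y)%R.
    by rewrite !mulr_ge0 ?addr_ge0 ?mdist_ge0// ltW.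
  have -> : (fr y s = fr z0 s + (fr y s - fr z0 s))%R by rewrite addrC subrK.
  apply: le_trans (ler_normD _ _) _; rewrite lerD2l.
  by rewrite ler_norml /C; apply/andP; split; lra.
pose Fr y := fine (F y).
have FrE y : F y = (Fr y)%:E.
  rewrite fineK// F_def fE; exact: integrable_fin_num (int_fr y).
have Fr_def y : (Fr y)%:E = \int[mu]_s (fr y s)%:E by rewrite -FrE F_def {1}fE.
have z0_min y : (Fr z0 <= Fr y)%R.
  by rewrite -lee_fin -!FrE z0inf; apply: ereal_inf_lbound; exists y.
have [x [mx xmin xcvg]] := @proximal_point_ae_cvg _ H _ _ _ _ _ P fr Fr L p lambda
  xi x0 H_hadamard H_locally_compact fr_cvx mfr (fun s => ltW (L0 s)) mL iL2
  fr_growth int_fr Fr_def lambda_gt0 lambda_sum_sqr xi_independent xi_distribution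
  lambda_sum z0 z0_min.
exists x; split => //; last by rewrite fE.
move=> w; have infE : ereal_inf (range F) = F (x w).
  apply/eqP; rewrite eq_le ereal_inf_lbound//=; last by exists (x w).
  apply: le_ereal_inf_tmp => _ [y _ <-].
  by rewrite !FrE lee_fin; exact: xmin.
by split; rewrite infE// FrE.
Qed.
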